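(* Let $v,w:\mathbb{C}\rightarrow\mathbb{R}$ be two solutions of the sinh-Gordon equation, $v_{z\bar z}+\frac12\sinh(2v)=0$ and $w_{z\bar z}+\frac12\sinh(2w)=0$. Then there exists a $1$-parameter family of minimal immersions $\Phi_t:\mathbb{C}\rightarrow\mathbb{S}^2\times\mathbb{S}^2$, $t\in\mathbb{R}$, without complex points, whose induced metric is $4\cosh(v+w)\cosh(v-w)|dz|^2$, whose Kähler functions are $C_1=\tanh(v-w)$ and $C_2=\tanh(v+w)$, and whose Hopf $2$-differentials are $\Theta_t=e^{it}dz\otimes dz$.
   Context: $\mathbb{S}^2\subset\mathbb{R}^3$ has standard metric, complex structure $J$ ($J_xv=x\times v$), Kähler form $\omega=\langle J\cdot,\cdot\rangle$. $\mathbb{S}^2\times\mathbb{S}^2$ has the product metric, $J_1=(J,J)$, $J_2=(J,-J)$, Kähler forms $\omega_1=\pi_1^*\omega+\pi_2^*\omega$, $\omega_2=\pi_1^*\omega-\pi_2^*\omega$, orientation $\pi_1^*\omega\wedge\pi_2^*\omega$. Kähler functions: $\Phi^*\omega_j=C_j\omega_\Sigma$; complex points: where $C_1^2=1$ or $C_2^2=1$. The Hopf $2$-differential of a minimal immersion $\Phi$ is $\Theta=\frac12\langle J_1\Phi_z,J_2\Phi_z\rangle\,dz\otimes dz$ for a conformal parameter $z$, $\langle\cdot,\cdot\rangle$ extended complex-bilinearly, $\partial_z=\frac12(\partial_x-i\partial_y)$. *)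

(* Defs.v *)
From Stdlib Require Import Reals.
From Coquelicot Require Import Coquelicot.
Open Scope R_scope.

(* ---------- real functions on C = R^2 (coordinates z = x + i y) ---------- *)
Definition pdx (f : R -> R -> R) (x y : R) : R := Derive (fun t => f t y) x.
Definition pdy (f : R -> R -> R) (x y : R) : R := Derive (fun t => f x t) y.

Definition cont2 (f : R -> R -> R) : Prop :=
  forall x y : R, continuous (fun p : (R * R)%type => f (fst p) (snd p)) (x, y).

Definition C2 (f : R -> R -> R) : Prop :=
  (forall x y, ex_derive (fun t => f t y) x /\ ex_derive (fun t => f x t) y) /\
  (forall x y, ex_derive (fun t => pdx f t y) x /\ ex_derive (fun t => pdx f x t) y /\
               ex_derive (fun t => pdy f t y) x /\ ex_derive (fun t => pdy f x t) y) /\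
  cont2 f /\ cont2 (pdx f) /\ cont2 (pdy f) /\
  cont2 (pdx (pdx f)) /\ cont2 (pdy (pdx f)) /\
  cont2 (pdx (pdy f)) /\ cont2 (pdy (pdy f)).

Definition dzdzbar (f : R -> R -> R) (x y : R) : R :=
  / 4 * (pdx (pdx f) x y + pdy (pdy f) x y).

Definition sinh_Gordon_solution (v : R -> R -> R) : Prop :=
  C2 v /\ forall x y, dzdzbar v x y + / 2 * sinh (2 * v x y) = 0.

Record V3 := mkV3 { c1 : R; c2 : R; c3 : R }.
Definition dot (a b : V3) : R := c1 a * c1 b + c2 a * c2 b + c3 a * c3 b.
Definition cross (a b : V3) : V3 :=
  mkV3 (c2 a * c3 b - c3 a * c2 b) (c3 a * c1 b - c1 a * c3 b) (c1 a * c2 b - c2 a * c1 b).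
Definition vadd (a b : V3) : V3 := mkV3 (c1 a + c1 b) (c2 a + c2 b) (c3 a + c3 b).
Definition vscal (s : R) (a : V3) : V3 := mkV3 (s * c1 a) (s * c2 a) (s * c3 a).
Definition vopp (a : V3) : V3 := vscal (-1) a.
Definition vzero : V3 := mkV3 0 0 0.

Definition Jsph (x u : V3) : V3 := cross x u.
Definition omega_sph (x u v : V3) : R := dot (Jsph x u) v.

Definition in_S2 (a : V3) : Prop := dot a a = 1.

Definition vmap := R -> R -> V3.
Definition comp1 (f : vmap) : R -> R -> R := fun x y => c1 (f x y).
Definition comp2 (f : vmap) : R -> R -> R := fun x y => c2 (f x y).
Definition comp3 (f : vmap) : R -> R -> R := fun x y => c3 (f x y).
Definition vdx (f : vmap) : vmap := fun x y =>
  mkV3 (pdx (comp1 f) x y) (pdx (comp2 f) x y) (pdx (comp3 f) x y).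
Definition vdy (f : vmap) : vmap := fun x y =>
  mkV3 (pdy (comp1 f) x y) (pdy (comp2 f) x y) (pdy (comp3 f) x y).
Definition vC2 (f : vmap) : Prop := C2 (comp1 f) /\ C2 (comp2 f) /\ C2 (comp3 f).
Definition vlap (f : vmap) : vmap := fun x y =>
  vadd (vdx (vdx f) x y) (vdy (vdy f) x y).

Definition pdot (a b : V3 * V3) : R := dot (fst a) (fst b) + dot (snd a) (snd b).
Definition Phi_x (p q : vmap) (x y : R) : V3 * V3 := (vdx p x y, vdx q x y).
Definition Phi_y (p q : vmap) (x y : R) : V3 * V3 := (vdy p x y, vdy q x y).

Definition metE (p q : vmap) x y := pdot (Phi_x p q x y) (Phi_x p q x y).
Definition metF (p q : vmap) x y := pdot (Phi_x p q x y) (Phi_y p q x y).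
Definition metG (p q : vmap) x y := pdot (Phi_y p q x y) (Phi_y p q x y).

Definition maps_into_S2xS2 (p q : vmap) : Prop :=
  forall x y, in_S2 (p x y) /\ in_S2 (q x y).

Definition is_immersion (p q : vmap) : Prop :=
  forall x y, metE p q x y * metG p q x y - metF p q x y ^ 2 > 0.

Definition induced_metric_is (p q : vmap) (lam : R -> R -> R) : Prop :=
  forall x y, metE p q x y = lam x y /\ metF p q x y = 0 /\ metG p q x y = lam x y.

Definition tproj (a u : V3) : V3 := vadd u (vscal (- dot u a) a).

(* Minimality.  For a conformal immersion (metric lam |dz|^2) into S^2 x S^2,
   the mean curvature vector is H = (1/(2 lam)) (Laplacian Phi)^T, where ^T is the
   orthogonal projection of R^3 x R^3 onto T_{Phi}(S^2 x S^2). *)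
Definition mean_curvature (p q : vmap) (x y : R) : V3 * V3 :=
  let lam := metE p q x y in
  (vscal (/ (2 * lam)) (tproj (p x y) (vlap p x y)),
   vscal (/ (2 * lam)) (tproj (q x y) (vlap q x y))).

Definition is_conformal (p q : vmap) : Prop :=
  forall x y, metE p q x y = metG p q x y /\ metF p q x y = 0.

Definition minimal_immersion (p q : vmap) : Prop :=
  vC2 p /\ vC2 q /\ maps_into_S2xS2 p q /\ is_immersion p q /\ is_conformal p q /\
  forall x y, mean_curvature p q x y = (vzero, vzero).

(* Kähler functions: Phi^* omega_j = C_j omega_Sigma, with omega_Sigma = lam dx ∧ dy
   the area form of the induced metric (orientation of C), and
   omega_1 = pi_1^* omega + pi_2^* omega, omega_2 = pi_1^* omega - pi_2^* omega. *)
Definition pullback_omega1 (p q : vmap) x y : R :=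
  omega_sph (p x y) (vdx p x y) (vdy p x y) + omega_sph (q x y) (vdx q x y) (vdy q x y).
Definition pullback_omega2 (p q : vmap) x y : R :=
  omega_sph (p x y) (vdx p x y) (vdy p x y) - omega_sph (q x y) (vdx q x y) (vdy q x y).
Definition area_density (p q : vmap) x y : R :=
  sqrt (metE p q x y * metG p q x y - metF p q x y ^ 2).
Definition Kahler_C1 (p q : vmap) x y : R := pullback_omega1 p q x y / area_density p q x y.
Definition Kahler_C2 (p q : vmap) x y : R := pullback_omega2 p q x y / area_density p q x y.

Definition no_complex_points (p q : vmap) : Prop :=
  forall x y, Kahler_C1 p q x y ^ 2 <> 1 /\ Kahler_C2 p q x y ^ 2 <> 1.

(* complexified vectors of R^3: (real part, imaginary part) *)
Definition CV3 := (V3 * V3)%type.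
Definition cdot (a b : CV3) : C :=
  (dot (fst a) (fst b) - dot (snd a) (snd b), dot (fst a) (snd b) + dot (snd a) (fst b)).
Definition cJ (x : V3) (u : CV3) : CV3 := (Jsph x (fst u), Jsph x (snd u)).
Definition cneg (u : CV3) : CV3 := (vopp (fst u), vopp (snd u)).
Definition vdz (f : vmap) (x y : R) : CV3 :=
  (vscal (/ 2) (vdx f x y), vscal (- / 2) (vdy f x y)).
(* Theta = 1/2 < J_1 Phi_z , J_2 Phi_z > dz ⊗ dz,
   J_1 = (J, J), J_2 = (J, -J), product metric extended complex-bilinearly *)
Definition Hopf_coeff (p q : vmap) (x y : R) : C :=
  let pz := vdz p x y in let qz := vdz q x y in
  Cmult (RtoC (/ 2))
    (Cplus (cdot (cJ (p x y) pz) (cJ (p x y) pz))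
           (cdot (cJ (q x y) qz) (cneg (cJ (q x y) qz)))).

(* Main.v *)
(** A minimal surface in S^2 x S^2 is a pair of harmonic maps into S^2 with opposite Hopf
    differentials.  For a solution v of the sinh-Gordon equation and an angle t, a harmonic map p
    with <p_z, p_z> = e^(it) and Jacobian 2 sinh (2 v) comes from an orthonormal frame (p, e1, e2)
    with p_z = e^(it/2) (cosh v e1 - i sinh v e2) and connection form -v_y dx + v_x dy.  Each
    coordinate of the frame is a vector u of R^3 with u_x = Om x u and u_y = Lam x u, and the
    integrability condition Om_y - Lam_x + Om x Lam = 0 is the sinh-Gordon equation.  The system
    is solved by Picard iteration along the line x = 0 and then along the lines y = const; that
    the result also satisfies the second equation off x = 0 is a Gronwall estimate, which is
    particularly simple because the coefficients are skew.  The surface is (p, q) with p built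
    from (v, t) and q from (-w, t + pi). *)
Require Import Defs.
From Stdlib Require Import Reals Lra Lia FunctionalExtensionality.
From Coquelicot Require Import Coquelicot.
(* Again after Reals, whose record projection [c1] hides the coordinate [c1] of [V3]. *)
Import Defs.
Open Scope R_scope.

(** * The flow of a rotation field *)

(** For a conformal pair, minimality says that each factor is harmonic, and conformality is <p_z,
    p_z> + <q_z, q_z> = 0; this forces the opposite Hopf differentials and lets one construction
    serve both factors. The angle enters only through the phase e^(it/2) of p_z and drops out of the
    integrability condition, so a single solution carries the whole family. The analytic obstacle is
    dependence on the parameter y: the flow along y = const depends on y through its field and its
    initial value, and nothing is known beforehand about its y-derivative, so mixed derivatives
    cannot be compared. Instead the candidate Lam x u is inserted into the Taylor remainder in y,
    which yields existence and value of the derivative together. The field Om x u is orthogonal to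
    u, so the norm is constant; this feeds the Gronwall estimates and later bounds the x-derivative,
    from which joint continuity follows. Since so(3) is R^3 with the cross product, vectors replace
    matrices, and two solutions determine the third by their cross product. *)

Ltac split3 := refine (conj _ (conj _ _)).

Lemma is_derive_eq (f : R -> R) (x d d' : R) :
  is_derive f x d -> d = d' -> is_derive f x d'.
Proof. intros H <-; exact H. Qed.

Lemma is_derive_Rplus (f g : R -> R) (x df dg : R) :
  is_derive f x df -> is_derive g x dg -> is_derive (fun s => f s + g s) x (df + dg).
Proof. intros Hf Hg; exact (is_derive_plus f g x df dg Hf Hg). Qed.

Lemma is_derive_Rminus (f g : R -> R) (x df dg : R) :
  is_derive f x df -> is_derive g x dg -> is_derive (fun s => f s - g s) x (df - dg).
Proof. intros Hf Hg; exact (is_derive_minus f g x df dg Hf Hg). Qed.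

Lemma is_derive_Rmult (f g : R -> R) (x df dg : R) :
  is_derive f x df -> is_derive g x dg ->
  is_derive (fun s => f s * g s) x (df * g x + f x * dg).
Proof. intros Hf Hg; exact (is_derive_mult f g x df dg Hf Hg Rmult_comm). Qed.

Lemma is_derive_Rconst (c x : R) : is_derive (fun _ => c) x 0.
Proof. exact (is_derive_const c x). Qed.

Lemma is_derive_Rscal (c : R) (f : R -> R) (x df : R) :
  is_derive f x df -> is_derive (fun s => c * f s) x (c * df).
Proof. exact (is_derive_scal f x c df). Qed.

Lemma is_derive_continuity_pt (f : R -> R) (x d : R) :
  is_derive f x d -> continuity_pt f x.
Proof.
  intros H; apply continuity_pt_filterlim.
  apply (ex_derive_continuous f x); exists d; exact H.
Qed.

Lemma is_derive_cosh (x : R) : is_derive cosh x (sinh x).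
Proof. apply is_derive_Reals, derivable_pt_lim_cosh. Qed.

Lemma is_derive_sinh (x : R) : is_derive sinh x (cosh x).
Proof. apply is_derive_Reals, derivable_pt_lim_sinh. Qed.

Lemma cosh_sqr (x : R) : cosh x * cosh x = 1 + sinh x * sinh x.
Proof.
  unfold cosh, sinh; generalize (exp_plus x (- x)).
  rewrite Rplus_opp_r, exp_0; intros H; nra.
Qed.

Lemma cosh_pos (x : R) : 0 < cosh x.
Proof. unfold cosh; generalize (exp_pos x) (exp_pos (- x)); lra. Qed.

Lemma cosh_ge_1 (x : R) : 1 <= cosh x.
Proof. generalize (cosh_sqr x) (cosh_pos x); nra. Qed.

Lemma Rabs_sinh_le_cosh (x : R) : Rabs (sinh x) <= cosh x.
Proof.
  unfold cosh, sinh; generalize (exp_pos x) (exp_pos (- x)); intros.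
  apply Rabs_le; lra.
Qed.

Lemma cosh_opp (x : R) : cosh (- x) = cosh x.
Proof. unfold cosh; rewrite Ropp_involutive; lra. Qed.

Lemma sinh_opp (x : R) : sinh (- x) = - sinh x.
Proof. unfold sinh; rewrite Ropp_involutive; lra. Qed.

Lemma cosh_le_Rabs (x y : R) : Rabs x <= y -> cosh x <= cosh y.
Proof.
  intros H.
  assert (Hx : Rabs (sinh x) <= sinh y).
  { assert (K : forall a, a <= y -> sinh a <= sinh y).
    { intros a [Ha| ->]; [left; now apply sinh_lt | lra]. }
    apply Rabs_le_between in H; apply Rabs_le; split.
    - generalize (K (- x)); rewrite sinh_opp; lra.
    - apply K; lra. }
  generalize (cosh_sqr x) (cosh_sqr y) (cosh_pos x) (cosh_pos y).
  apply Rabs_le_between in Hx; nra.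
Qed.

(* With the weight [cosh (L * x)] the Picard iteration becomes a contraction on arbitrarily
   long intervals. *)
Lemma cosh_weight_primitive (f df : R -> R) (X L C : R) :
  0 < L -> 0 <= C -> f 0 = 0 ->
  (forall s, Rabs s <= X -> is_derive f s (df s)) ->
  (forall s, Rabs s <= X -> Rabs (df s) <= C * cosh (L * s)) ->
  forall x, Rabs x <= X -> Rabs (f x) <= C / L * cosh (L * x).
Proof.
  intros HL HC Hf0 Hf Hdf x Hx.
  assert (Hin : forall s, Rmin 0 x <= s <= Rmax 0 x -> Rabs s <= X).
  { intros s; revert Hx; unfold Rmin, Rmax, Rabs.
    destruct (Rle_dec 0 x); repeat destruct Rcase_abs; lra. }
  assert (Hsinh : forall s, is_derive (fun s => C / L * sinh (L * s)) s (C * cosh (L * s))).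
  { intros s. eapply is_derive_eq.
    - apply is_derive_Rscal.
      apply (is_derive_comp sinh (fun s => L * s) s (cosh (L * s)) (L * 1)).
      + apply is_derive_sinh.
      + apply is_derive_Rscal; exact (is_derive_id s).
    - unfold scal; simpl; unfold mult; simpl; field; lra. }
  (* The comparison function C/L sinh (L s) has a derivative that dominates |f'|. After the mean
     value theorem, a nonnegative factor multiplies x, so the two choices of e give |f x| <= C/L
     |sinh (L x)| on both sides of 0. *)
  assert (Key : forall e, e = 1 \/ e = -1 ->
    exists c, Rmin 0 x <= c <= Rmax 0 x /\
      C / L * sinh (L * x) - e * f x = (C * cosh (L * c) - e * df c) * x).
  { intros e _.
    destruct (MVT_gen (fun s => C / L * sinh (L * s) - e * f s) 0 x
      (fun s => C * cosh (L * s) - e * df s)) as [c [Hc E]].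
    - intros s Hs; apply is_derive_Rminus; [apply Hsinh | apply is_derive_Rscal, Hf, Hin; lra].
    - intros s Hs; eapply is_derive_continuity_pt, is_derive_Rminus;
        [apply Hsinh | apply is_derive_Rscal, Hf, Hin; lra].
    - exists c; split; [exact Hc|]. revert E.
      rewrite Hf0, Rmult_0_r, sinh_0; intros E; nra. }
  destruct (Key 1) as [c [Hc E1]]; [now left|].
  destruct (Key (-1)) as [d [Hd E2]]; [now right|].
  generalize (Hdf c (Hin c Hc)) (Hdf d (Hin d Hd)); intros Dc Dd.
  apply Rabs_le_between in Dc; apply Rabs_le_between in Dd.
  assert (HCL : 0 <= C / L) by (apply Rdiv_le_0_compat; lra).
  assert (Rabs (f x) <= C / L * Rabs (sinh (L * x))).
  { rewrite <- (Rabs_pos_eq (C / L)), <- Rabs_mult; [|exact HCL].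
    destruct (Rle_dec 0 x).
    - rewrite (Rabs_pos_eq (C / L * sinh (L * x))); [apply Rabs_le|]; nra.
    - rewrite (Rabs_left1 (C / L * sinh (L * x))); [apply Rabs_le|]; nra. }
  eapply Rle_trans; [exact H|].
  apply Rmult_le_compat_l; [exact HCL | apply Rabs_sinh_le_cosh].
Qed.

(** The geometric increments telescope. Keeping the difference of the powers at n and n + k in the
    bound is what lets the induction on k close. *)
Lemma CVU_dom_geom (f : nat -> R -> R) (D : R -> Prop) (K : R) :
  0 <= K ->
  (forall n x, D x -> Rabs (f (S n) x - f n x) <= K * (/ 2) ^ n) -> CVU_dom f D.
Proof.
  intros HK H; apply CVU_dom_cauchy.
  assert (Hq : forall n, 0 < (/ 2) ^ n) by (intros n; apply pow_lt; lra).
  assert (Hd : forall n k x, D x ->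
    Rabs (f (n + k)%nat x - f n x) <= 2 * K * ((/ 2) ^ n - (/ 2) ^ (n + k))).
  { intros n k x Hx; induction k as [|k IH].
    - rewrite Nat.add_0_r; rewrite !Rminus_diag, Rabs_R0; lra.
    - rewrite Nat.add_succ_r.
      replace (f (S (n + k)) x - f n x)
        with ((f (S (n + k)) x - f (n + k)%nat x) + (f (n + k)%nat x - f n x)) by ring.
      eapply Rle_trans; [apply Rabs_triang|].
      generalize (H (n + k)%nat x Hx); simpl; lra. }
  intros eps.
  (* Two terms of index at least N both lie within 2 K (1/2)^N of the N-th one, hence the 4 K; the
     added 1 covers K = 0. *)
  destruct (pow_lt_1_zero (/ 2)) with (y := eps / (4 * K + 1)) as [N HN].
  { rewrite Rabs_pos_eq; lra. }
  { apply Rdiv_lt_0_compat; [apply eps | lra]. }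
  exists N; intros n m x Hx Hn Hm.
  assert (Hb : forall j, (N <= j)%nat -> Rabs (f j x - f N x) <= 2 * K * (/ 2) ^ N).
  { intros j Hj; replace j with (N + (j - N))%nat by lia.
    eapply Rle_trans; [apply Hd, Hx|].
    generalize (Hq (N + (j - N))%nat); nra. }
  replace (f n x - f m x) with ((f n x - f N x) - (f m x - f N x)) by ring.
  eapply Rle_lt_trans; [apply Rabs_triang|]; rewrite Rabs_Ropp.
  generalize (HN N (Nat.le_refl N)); rewrite Rabs_pos_eq; [|left; apply Hq].
  generalize (Hb n Hn) (Hb m Hm) (Hq N); intros H1 H2 H4 H3; apply Rlt_div_r in H3; [nra | lra].
Qed.

(** * Picard iteration for u' = Om x u *)

Definition is_vderive (u : R -> V3) (x : R) (d : V3) : Prop :=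
  is_derive (fun s => c1 (u s)) x (c1 d) /\
  is_derive (fun s => c2 (u s)) x (c2 d) /\
  is_derive (fun s => c3 (u s)) x (c3 d).

Definition vcontinuous (u : R -> V3) : Prop :=
  forall x, continuous (fun s => c1 (u s)) x /\
            continuous (fun s => c2 (u s)) x /\
            continuous (fun s => c3 (u s)) x.

Definition vprim (u : R -> V3) (x : R) : V3 :=
  mkV3 (RInt (fun s => c1 (u s)) 0 x)
       (RInt (fun s => c2 (u s)) 0 x)
       (RInt (fun s => c3 (u s)) 0 x).

Fixpoint picard (Om : R -> V3) (u0 : V3) (n : nat) : R -> V3 :=
  match n with
  | O => fun _ => u0
  | S n => fun x => vadd u0 (vprim (fun s => cross (Om s) (picard Om u0 n s)) x)
  end.

(** [Lim_seq] is total, so the flow is a plain function of any field; for continuous [Om] the limit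
    is shown below to be genuine. *)
Definition rot_flow (Om : R -> V3) (u0 : V3) (x : R) : V3 :=
  mkV3 (Lim_seq (fun n => c1 (picard Om u0 n x)))
       (Lim_seq (fun n => c2 (picard Om u0 n x)))
       (Lim_seq (fun n => c3 (picard Om u0 n x))).

Lemma is_derive_RInt_continuous (f : R -> R) (x : R) :
  (forall s, continuous f s) -> is_derive (fun b => RInt f 0 b) x (f x).
Proof.
  intros Hf; apply is_derive_RInt with (a := 0); [|apply Hf].
  apply filter_forall; intros b; apply (RInt_correct (V := R_CompleteNormedModule)).
  apply (ex_RInt_continuous (V := R_CompleteNormedModule)); intros; apply Hf.
Qed.

Lemma continuous_cross_sub (f g h k : R -> R) x :
  continuous f x -> continuous g x -> continuous h x -> continuous k x ->
  continuous (fun s => f s * g s - h s * k s) x.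
Proof.
  intros Hf Hg Hh Hk.
  apply (continuous_minus (fun s => f s * g s) (fun s => h s * k s) x);
    [exact (continuous_mult f g x Hf Hg) | exact (continuous_mult h k x Hh Hk)].
Qed.

Lemma vcontinuous_cross (Om u : R -> V3) :
  vcontinuous Om -> vcontinuous u -> vcontinuous (fun s => cross (Om s) (u s)).
Proof.
  intros HO Hu x; destruct (HO x) as (? & ? & ?), (Hu x) as (? & ? & ?).
  unfold cross; simpl; split3; now apply continuous_cross_sub.
Qed.

Lemma vprim_derive (u : R -> V3) (u0 : V3) (x : R) :
  vcontinuous u -> is_vderive (fun s => vadd u0 (vprim u s)) x (u x).
Proof.
  intros Hu.
  assert (H : forall (f : R -> R) (a : R), (forall s, continuous f s) ->
    is_derive (fun s => a + RInt f 0 s) x (f x)).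
  { intros f a Hf; apply (is_derive_eq _ _ (0 + f x)); [|apply Rplus_0_l].
    apply is_derive_Rplus; [apply is_derive_Rconst | now apply is_derive_RInt_continuous]. }
  split3; [apply (H (fun s => c1 (u s))) | apply (H (fun s => c2 (u s)))
    | apply (H (fun s => c3 (u s)))]; intros s; destruct (Hu s) as (? & ? & ?); assumption.
Qed.

Lemma vderive_continuous (u du : R -> V3) :
  (forall x, is_vderive u x (du x)) -> vcontinuous u.
Proof.
  intros H x; destruct (H x) as (H1 & H2 & H3); split3;
    apply (ex_derive_continuous (K := R_AbsRing) (V := R_NormedModule)); eexists; eassumption.
Qed.

Lemma picard_continuous (Om : R -> V3) (u0 : V3) (n : nat) :
  vcontinuous Om -> vcontinuous (picard Om u0 n).
Proof.
  intros HO; induction n as [|n IH].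
  - intros x; simpl; split3; apply continuous_const.
  - apply (vderive_continuous _ (fun s => cross (Om s) (picard Om u0 n s))).
    intros x; apply (vprim_derive (fun s => cross (Om s) (picard Om u0 n s))).
    now apply vcontinuous_cross.
Qed.

Lemma picard_derive (Om : R -> V3) (u0 : V3) (n : nat) (x : R) :
  vcontinuous Om ->
  is_vderive (picard Om u0 (S n)) x (cross (Om x) (picard Om u0 n x)).
Proof.
  intros HO; apply (vprim_derive (fun s => cross (Om s) (picard Om u0 n s))).
  apply vcontinuous_cross; [exact HO | now apply picard_continuous].
Qed.

Lemma picard_0 (Om : R -> V3) (u0 : V3) (n : nat) : picard Om u0 n 0 = u0.
Proof.
  destruct n; [reflexivity|].
  simpl; unfold vprim, vadd; simpl; rewrite !RInt_point; unfold zero; simpl.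
  rewrite !Rplus_0_r; now destruct u0.
Qed.

Lemma vcontinuous_bound (u : R -> V3) (X : R) :
  vcontinuous u ->
  exists M, 0 < M /\ forall x, Rabs x <= X ->
    Rabs (c1 (u x)) <= M /\ Rabs (c2 (u x)) <= M /\ Rabs (c3 (u x)) <= M.
Proof.
  intros Hu.
  destruct (bounded_continuity (fun s => c1 (u s)) (- X) X) as [M1 H1];
    [intros s _; destruct (Hu s) as (? & ? & ?); assumption|].
  destruct (bounded_continuity (fun s => c2 (u s)) (- X) X) as [M2 H2];
    [intros s _; destruct (Hu s) as (? & ? & ?); assumption|].
  destruct (bounded_continuity (fun s => c3 (u s)) (- X) X) as [M3 H3];
    [intros s _; destruct (Hu s) as (? & ? & ?); assumption|].
  exists (Rabs M1 + Rabs M2 + Rabs M3 + 1).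
  generalize (Rabs_pos M1) (Rabs_pos M2) (Rabs_pos M3); intros P1 P2 P3.
  split; [lra|]; intros x Hx; apply Rabs_le_between in Hx.
  specialize (H1 x Hx); specialize (H2 x Hx); specialize (H3 x Hx).
  change norm with Rabs in H1, H2, H3.
  generalize (Rle_abs M1) (Rle_abs M2) (Rle_abs M3); lra.
Qed.

Lemma Rabs_cross_sub_le (a b c d M B : R) :
  Rabs a <= M -> Rabs c <= M -> Rabs b <= B -> Rabs d <= B ->
  Rabs (a * b - c * d) <= 2 * M * B.
Proof.
  intros Ha Hc Hb Hd.
  eapply Rle_trans; [apply Rabs_triang|]; rewrite Rabs_Ropp, !Rabs_mult.
  generalize (Rabs_pos a) (Rabs_pos b) (Rabs_pos c) (Rabs_pos d); nra.
Qed.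

(** A component of a cross product is a difference of two products, so an increment has derivative
    at most 2 M times the previous bound. Integration against the weight cosh (4 M x) divides by 4
    M, which leaves the ratio 1/2 whatever the length X. *)
Lemma picard_step (Om : R -> V3) (u0 : V3) (X M : R) :
  vcontinuous Om -> 0 < M ->
  (forall x, Rabs x <= X ->
    Rabs (c1 (Om x)) <= M /\ Rabs (c2 (Om x)) <= M /\ Rabs (c3 (Om x)) <= M) ->
  let K := Rabs (c1 u0) + Rabs (c2 u0) + Rabs (c3 u0) in
  let B n x := K * (/ 2) ^ n * cosh (4 * M * x) in
  forall n x, Rabs x <= X ->
  Rabs (c1 (picard Om u0 (S n) x) - c1 (picard Om u0 n x)) <= B n x /\
  Rabs (c2 (picard Om u0 (S n) x) - c2 (picard Om u0 n x)) <= B n x /\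
  Rabs (c3 (picard Om u0 (S n) x) - c3 (picard Om u0 n x)) <= B n x.
Proof.
  intros HO HM HB K B.
  generalize (Rabs_pos (c1 u0)) (Rabs_pos (c2 u0)) (Rabs_pos (c3 u0)); intros P1 P2 P3.
  assert (HK : 0 <= K) by (unfold K; lra).
  assert (Hq : forall n, 0 < (/ 2) ^ n) by (intros n; apply pow_lt; lra).
  assert (Gen : forall (f df : R -> R) C, 0 <= C -> f 0 = 0 ->
    (forall s, Rabs s <= X -> is_derive f s (df s)) ->
    (forall s, Rabs s <= X -> Rabs (df s) <= 2 * M * (C * cosh (4 * M * s))) ->
    forall x, Rabs x <= X -> Rabs (f x) <= / 2 * C * cosh (4 * M * x)).
  { intros f df C HC H0 Hf Hdf x Hx.
    replace (/ 2 * C) with (2 * M * C / (4 * M)) by (field; lra).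
    apply (cosh_weight_primitive f df X); try lra; try assumption; [nra|].
    intros s Hs; rewrite Rmult_assoc; now apply Hdf. }
  intros n; induction n as [|n IH]; intros x Hx.
  (* The first increment is a primitive of Om x u0, whose components are at most 2 M K, hence at
     most 2 M K cosh (4 M s): [Gen] with C = K gives half of the required bound. *)
  - assert (Z : forall e, Rabs e <= / 2 * K * cosh (4 * M * x) -> Rabs e <= B 0%nat x).
    { intros e He; unfold B; generalize (cosh_pos (4 * M * x)); simpl; nra. }
    assert (U : forall s, K <= K * cosh (4 * M * s)).
    { intros s; generalize (cosh_ge_1 (4 * M * s)); nra. }
    split3; apply Z;
      [ apply (Gen (fun s => c1 (picard Om u0 1 s) - c1 u0) (fun s => c1 (cross (Om s) u0) - 0))
      | apply (Gen (fun s => c2 (picard Om u0 1 s) - c2 u0) (fun s => c2 (cross (Om s) u0) - 0))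
      | apply (Gen (fun s => c3 (picard Om u0 1 s) - c3 u0) (fun s => c3 (cross (Om s) u0) - 0)) ].
    1, 6, 11: exact HK.
    1, 5, 9: rewrite picard_0; ring.
    1, 4, 7: intros s Hs; apply is_derive_Rminus;
             [apply (picard_derive Om u0 0 s HO) | apply is_derive_Rconst].

    2, 4, 6: exact Hx.
    1-3: intros s Hs; destruct (HB s Hs) as (B1 & B2 & B3); rewrite Rminus_0_r; simpl;
      apply Rabs_cross_sub_le; trivial; eapply Rle_trans; try apply U; unfold K; lra.
  - assert (Z : B (S n) x = / 2 * (K * (/ 2) ^ n) * cosh (4 * M * x)) by (unfold B; simpl; ring).
    assert (HC : 0 <= K * (/ 2) ^ n) by (generalize (Hq n); nra).
    rewrite !Z.
    assert (D : forall s a b c d a' b' c' d', Rabs s <= X ->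
      Rabs a <= M -> Rabs c <= M -> a' = a -> c' = c ->
      Rabs (b - b') <= B n s -> Rabs (d - d') <= B n s ->
      Rabs ((a * b - c * d) - (a' * b' - c' * d')) <= 2 * M * (K * (/ 2) ^ n * cosh (4 * M * s))).
    { intros s a b c d a' b' c' d' Hs Ha Hc -> -> Hb Hd.
      replace (a * b - c * d - (a * b' - c * d')) with (a * (b - b') - c * (d - d')) by ring.
      now apply Rabs_cross_sub_le. }
    pose (P := picard Om u0).
    split3;
      [ apply (Gen (fun s => c1 (P (S (S n)) s) - c1 (P (S n) s))
          (fun s => c1 (cross (Om s) (P (S n) s)) - c1 (cross (Om s) (P n s))))
      | apply (Gen (fun s => c2 (P (S (S n)) s) - c2 (P (S n) s))
          (fun s => c2 (cross (Om s) (P (S n) s)) - c2 (cross (Om s) (P n s))))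
      | apply (Gen (fun s => c3 (P (S (S n)) s) - c3 (P (S n) s))
          (fun s => c3 (cross (Om s) (P (S n) s)) - c3 (cross (Om s) (P n s)))) ].
    1, 6, 11: exact HC.
    1, 5, 9: unfold P; rewrite !picard_0; ring.
    1, 4, 7: intros s Hs; destruct (picard_derive Om u0 n s HO) as (? & ? & ?),
             (picard_derive Om u0 (S n) s HO) as (? & ? & ?); apply is_derive_Rminus; assumption.
    2, 4, 6: exact Hx.
    1-3: intros s Hs; destruct (HB s Hs) as (B1 & B2 & B3), (IH s Hs) as (I1 & I2 & I3);
      unfold cross; cbn [c1 c2 c3]; apply D; trivial.
Qed.

(** On the interval the weight is at most its value at X, which turns the weighted estimate into a
    uniform one. The bound M on the field is returned too, because the derivatives of the iterates
    are estimated with it. *)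
Lemma picard_geom (Om : R -> V3) (u0 : V3) (X : R) :
  vcontinuous Om -> 0 <= X ->
  exists K M, 0 <= K /\ 0 <= M /\
    (forall n x, Rabs x <= X ->
      Rabs (c1 (picard Om u0 (S n) x) - c1 (picard Om u0 n x)) <= K * (/ 2) ^ n /\
      Rabs (c2 (picard Om u0 (S n) x) - c2 (picard Om u0 n x)) <= K * (/ 2) ^ n /\
      Rabs (c3 (picard Om u0 (S n) x) - c3 (picard Om u0 n x)) <= K * (/ 2) ^ n) /\
    (forall x, Rabs x <= X ->
      Rabs (c1 (Om x)) <= M /\ Rabs (c2 (Om x)) <= M /\ Rabs (c3 (Om x)) <= M).
Proof.
  intros HO HX.
  destruct (vcontinuous_bound Om X HO) as (M & HM & HB).
  generalize (Rabs_pos (c1 u0)) (Rabs_pos (c2 u0)) (Rabs_pos (c3 u0)); intros P1 P2 P3.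
  pose (K := Rabs (c1 u0) + Rabs (c2 u0) + Rabs (c3 u0)).
  assert (HK : 0 <= K) by (unfold K; lra).
  exists (K * cosh (4 * M * X)), M; generalize (cosh_pos (4 * M * X)); intros Hc.
  split; [nra|]; split; [lra|]; split; [intros n x Hx; split3 | exact HB];
    (eapply Rle_trans; [apply (picard_step Om u0 X M HO HM HB n x); assumption|]; fold K;
     assert (cosh (4 * M * x) <= cosh (4 * M * X));
     [ apply cosh_le_Rabs; rewrite Rabs_mult, (Rabs_pos_eq (4 * M)); nra
     | assert (0 < (/ 2) ^ n) by (apply pow_lt; lra);
       assert (0 <= K * (/ 2) ^ n) by nra; nra ]).
Qed.

Lemma open_Rabs_lt (X : R) : open (fun x : R => Rabs x < X).
Proof.
  apply (open_comp Rabs (fun y => y < X)); [intros x _; apply continuous_Rabs | apply open_lt].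
Qed.

Lemma connected_Rabs_lt (X : R) : is_connected (fun x : R => Rabs x < X).
Proof.
  intros a b x Ha Hb Hx; apply Rabs_lt_between in Ha; apply Rabs_lt_between in Hb.
  apply Rabs_lt_between; lra.
Qed.

Lemma CVU_dom_is_lim_seq (f : nat -> R -> R) (D : R -> Prop) (x : R) :
  CVU_dom f D -> D x -> is_lim_seq (fun n => f n x) (real (Lim_seq (fun n => f n x))).
Proof.
  intros H Hx; apply Lim_seq_correct', (CVU_CVS_dom f D H x Hx).
Qed.

Lemma is_lim_seq_cross_sub (a c b d : R) (u v : nat -> R) :
  is_lim_seq u b -> is_lim_seq v d ->
  is_lim_seq (fun n => a * u n - c * v n) (a * b - c * d).
Proof.
  intros Hu Hv; apply is_lim_seq_minus';
    [exact (is_lim_seq_scal_l u a b Hu) | exact (is_lim_seq_scal_l v c d Hv)].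
Qed.

(** Limit and derivative are exchanged under uniform convergence of both sequences. The derivative
    of the iterate n + 1 is computed from the iterate n, so the argument runs on the shifted
    sequence, which has the same limit. *)
Lemma is_derive_Lim_seq_geom (f df : nat -> R -> R) (g : R) (X K x : R) :
  0 <= K -> Rabs x < X ->
  (forall n s, Rabs s < X -> Rabs (f (S n) s - f n s) <= K * (/ 2) ^ n) ->
  (forall n s, Rabs s < X -> Rabs (df (S n) s - df n s) <= K * (/ 2) ^ n) ->
  (forall n s, is_derive (f (S n)) s (df n s)) ->
  (forall n s, continuous (df n) s) ->
  is_lim_seq (fun n => df n x) g ->
  is_derive (fun s => real (Lim_seq (fun n => f n s))) x g.
Proof.
  intros HK Hx Hf Hdf Hd Hc Hg.
  assert (Ed : forall n, Derive (f (S n)) = df n).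
  { intros n; apply functional_extensionality; intros s; now apply is_derive_unique. }
  apply is_derive_ext with (f := fun s => real (Lim_seq (fun n => f (S n) s))).
  { intros s; f_equal; apply (Lim_seq_incr_1 (fun n => f n s)). }
  replace g with (real (Lim_seq (fun n => Derive (f (S n)) x))).
  - apply (CVU_Derive (fun n => f (S n)) (fun x => Rabs x < X)); trivial.
    + apply open_Rabs_lt.
    + apply connected_Rabs_lt.
    + apply (CVU_dom_geom _ _ K HK); intros n s Hs.
      eapply Rle_trans; [now apply Hf|]; simpl.
      assert (0 < (/ 2) ^ n) by (apply pow_lt; lra); nra.
    + intros n s _; exists (df n s); apply Hd.
    + intros n s _; rewrite Ed; apply continuity_pt_filterlim, Hc.
    + apply (CVU_dom_geom _ _ K HK); intros n s Hs; rewrite !Ed; now apply Hdf.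
  - rewrite (Lim_seq_ext _ (fun n => df n x)) by (intros n; now rewrite Ed).
    now rewrite (is_lim_seq_unique _ _ Hg).
Qed.

Lemma rot_flow_0 (Om : R -> V3) (u0 : V3) : rot_flow Om u0 0 = u0.
Proof.
  unfold rot_flow.
  rewrite (Lim_seq_ext _ (fun _ => c1 u0)) by (intros; now rewrite picard_0).
  rewrite (Lim_seq_ext (fun n => c2 _) (fun _ => c2 u0)) by (intros; now rewrite picard_0).
  rewrite (Lim_seq_ext (fun n => c3 _) (fun _ => c3 u0)) by (intros; now rewrite picard_0).
  rewrite !Lim_seq_const; now destruct u0.
Qed.

Lemma rot_flow_derive (Om : R -> V3) (u0 : V3) (x : R) :
  vcontinuous Om -> is_vderive (rot_flow Om u0) x (cross (Om x) (rot_flow Om u0 x)).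
Proof.
  intros HO.
  (* Differentiation of the limit requires x to be interior to the interval of uniform
     convergence. *)
  pose (X := Rabs x + 1); assert (HX : 0 <= X) by (unfold X; generalize (Rabs_pos x); lra).
  assert (Hx : Rabs x < X) by (unfold X; lra).
  destruct (picard_geom Om u0 X HO HX) as (K & M & HK & HM & HP & HB).
  assert (Hlim : is_lim_seq (fun n => c1 (picard Om u0 n x)) (c1 (rot_flow Om u0 x)) /\
                 is_lim_seq (fun n => c2 (picard Om u0 n x)) (c2 (rot_flow Om u0 x)) /\
                 is_lim_seq (fun n => c3 (picard Om u0 n x)) (c3 (rot_flow Om u0 x))).
  { split3;
      [ apply (CVU_dom_is_lim_seq (fun n s => c1 (picard Om u0 n s)) (fun s => Rabs s <= X))
      | apply (CVU_dom_is_lim_seq (fun n s => c2 (picard Om u0 n s)) (fun s => Rabs s <= X))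
      | apply (CVU_dom_is_lim_seq (fun n s => c3 (picard Om u0 n s)) (fun s => Rabs s <= X)) ];
      try lra; apply (CVU_dom_geom _ _ K HK); intros n s Hs; now apply HP. }
  destruct Hlim as (L1 & L2 & L3).
  assert (Hq : forall n, 0 < (/ 2) ^ n) by (intros n; apply pow_lt; lra).
  (* One constant for both sequences: K controls the iterates and 2 M K their derivatives. *)
  assert (HK' : 0 <= (1 + 2 * M) * K) by nra.
  assert (D : forall n a b c d b' d',
      Rabs a <= M -> Rabs c <= M ->
      Rabs (b - b') <= K * (/ 2) ^ n -> Rabs (d - d') <= K * (/ 2) ^ n ->
      Rabs ((a * b - c * d) - (a * b' - c * d')) <= (1 + 2 * M) * K * (/ 2) ^ n).
  { intros n a b c d b' d' Ha Hc Hb Hd.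
    replace (a * b - c * d - (a * b' - c * d')) with (a * (b - b') - c * (d - d')) by ring.
    eapply Rle_trans; [apply Rabs_cross_sub_le; eassumption|].
    generalize (Hq n); nra. }
  assert (HPK : forall n e, Rabs e <= K * (/ 2) ^ n -> Rabs e <= (1 + 2 * M) * K * (/ 2) ^ n).
  { intros n e He; generalize (Hq n); intros; assert (0 <= M * K) by nra; nra. }
  pose (W n s := cross (Om s) (picard Om u0 n s)).
  assert (HW : forall n, vcontinuous (W n)).
  { intros n; apply vcontinuous_cross; [exact HO | now apply picard_continuous]. }
  assert (HD : forall n s, is_vderive (picard Om u0 (S n)) s (W n s)).
  { intros n s; now apply picard_derive. }
  split3;
    [ apply (is_derive_Lim_seq_geom (fun n s => c1 (picard Om u0 n s)) (fun n s => c1 (W n s))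
        _ X _ x HK' Hx)
    | apply (is_derive_Lim_seq_geom (fun n s => c2 (picard Om u0 n s)) (fun n s => c2 (W n s))
        _ X _ x HK' Hx)
    | apply (is_derive_Lim_seq_geom (fun n s => c3 (picard Om u0 n s)) (fun n s => c3 (W n s))
        _ X _ x HK' Hx) ].
  1, 6, 11: intros n s Hs; apply HPK, HP; lra.
  1, 5, 9: intros n s Hs; destruct (HB s) as (? & ? & ?); [lra|];
           destruct (HP n s) as (? & ? & ?); [lra|]; apply D; assumption.
  1, 4, 7: intros n s; destruct (HD n s) as (? & ? & ?); assumption.
  1, 3, 5: intros n s; destruct (HW n s) as (? & ? & ?); assumption.
  all: now apply is_lim_seq_cross_sub.
Qed.

(** * The total system *)

Ltac vec_ring :=
  unfold vopp, vadd, vscal, cross, dot; cbn [c1 c2 c3];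
  first [ring | f_equal; ring].

Lemma dot_nonneg (a : V3) : 0 <= dot a a.
Proof. unfold dot; nra. Qed.

Lemma dot_cross_le (a b : V3) : dot (cross a b) (cross a b) <= dot a a * dot b b.
Proof.
  replace (dot (cross a b) (cross a b)) with (dot a a * dot b b - dot a b * dot a b)
    by vec_ring.
  nra.
Qed.

Lemma dot_vadd_le (a b : V3) :
  dot (vadd a b) (vadd a b) <= 2 * dot a a + 2 * dot b b.
Proof.
  assert (H : dot (vadd a b) (vadd a b) + dot (vadd a (vopp b)) (vadd a (vopp b))
    = 2 * dot a a + 2 * dot b b) by vec_ring.
  generalize (dot_nonneg (vadd a (vopp b))); lra.
Qed.

Lemma dot_vscal (h : R) (a : V3) : dot (vscal h a) (vscal h a) = h * h * dot a a.
Proof. vec_ring. Qed.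

Lemma is_vderive_eq (u : R -> V3) (x : R) (d d' : V3) :
  is_vderive u x d -> d = d' -> is_vderive u x d'.
Proof. intros H <-; exact H. Qed.

Lemma is_vderive_vadd (u w : R -> V3) (x : R) (du dw : V3) :
  is_vderive u x du -> is_vderive w x dw ->
  is_vderive (fun s => vadd (u s) (w s)) x (vadd du dw).
Proof.
  intros (U1 & U2 & U3) (W1 & W2 & W3); split3; cbn [vadd c1 c2 c3];
    now apply is_derive_Rplus.
Qed.

Lemma is_vderive_vscal (h : R) (u : R -> V3) (x : R) (du : V3) :
  is_vderive u x du -> is_vderive (fun s => vscal h (u s)) x (vscal h du).
Proof.
  intros (U1 & U2 & U3); split3; cbn [vscal c1 c2 c3]; now apply is_derive_Rscal.
Qed.

Lemma is_vderive_cross (u w : R -> V3) (x : R) (du dw : V3) :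
  is_vderive u x du -> is_vderive w x dw ->
  is_vderive (fun s => cross (u s) (w s)) x (vadd (cross du (w x)) (cross (u x) dw)).
Proof.
  intros (U1 & U2 & U3) (W1 & W2 & W3); split3; cbn [vadd cross c1 c2 c3];
    (eapply is_derive_eq;
     [apply is_derive_Rminus; apply is_derive_Rmult; eassumption | cbv beta; ring]).
Qed.

Lemma is_derive_dot (u w : R -> V3) (x : R) (du dw : V3) :
  is_vderive u x du -> is_vderive w x dw ->
  is_derive (fun s => dot (u s) (w s)) x (dot du (w x) + dot (u x) dw).
Proof.
  intros (U1 & U2 & U3) (W1 & W2 & W3); unfold dot.
  eapply is_derive_eq.
  - apply is_derive_Rplus; [apply is_derive_Rplus|]; apply is_derive_Rmult; eassumption.
  - cbv beta; ring.
Qed.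

Lemma is_derive_zero_const (f : R -> R) (a b : R) :
  (forall x, is_derive f x 0) -> f a = f b.
Proof.
  intros H; destruct (MVT_gen f a b (fun _ => 0)) as [c [_ E]].
  - intros x _; apply H.
  - intros x _; exact (is_derive_continuity_pt f x 0 (H x)).
  - lra.
Qed.

Lemma rot_flow_norm (Om : R -> V3) (u0 : V3) (x : R) :
  vcontinuous Om -> dot (rot_flow Om u0 x) (rot_flow Om u0 x) = dot u0 u0.
Proof.
  intros HO; rewrite <- (rot_flow_0 Om u0) at 3 4.
  apply (is_derive_zero_const (fun s => dot (rot_flow Om u0 s) (rot_flow Om u0 s))).
  intros s; eapply is_derive_eq.
  - apply is_derive_dot; apply rot_flow_derive, HO.
  - vec_ring.
Qed.

(* The skew term of the equation does no work, so the bound does not depend on [Om]. *)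
Lemma rot_gronwall (Om d r : R -> V3) (X e : R) :
  (forall x, Rabs x <= Rabs X -> is_vderive d x (vadd (cross (Om x) (d x)) (r x))) ->
  (forall x, Rabs x <= Rabs X -> dot (r x) (r x) <= e) ->
  dot (d X) (d X) <= exp (Rabs X) * (dot (d 0) (d 0) + e).
Proof.
  intros Hd Hr.
  assert (He : 0 <= e).
  { eapply Rle_trans; [apply dot_nonneg | apply (Hr 0)]; rewrite Rabs_R0; apply Rabs_pos. }
  assert (Hin : forall s, Rmin 0 X <= s <= Rmax 0 X -> Rabs s <= Rabs X).
  { intros s; unfold Rmin, Rmax, Rabs.
    destruct (Rle_dec 0 X); repeat destruct Rcase_abs; lra. }
  assert (Hsg : exists sg, sg * sg = 1 /\ sg * X = Rabs X).
  { unfold Rabs; destruct Rcase_abs; [exists (-1) | exists 1]; lra. }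
  destruct Hsg as (sg & Hsg & HX).
  (* With [sg] the sign of X, the weight decays from 0 towards X. In the derivative of g the skew
     term has vanished, and g decreases from 0 to X once 2 |d . r| <= |d|^2 + e is known. *)
  pose (g s := exp (- sg * s) * (dot (d s) (d s) + e)).
  assert (Dg : forall s, Rabs s <= Rabs X ->
    is_derive g s (exp (- sg * s) * (2 * dot (d s) (r s) - sg * (dot (d s) (d s) + e)))).
  { intros s Hs; unfold g; eapply is_derive_eq.
    - apply is_derive_Rmult.
      + apply (is_derive_comp exp (fun s => - sg * s) s (exp (- sg * s)) (- sg * 1)).
        * apply is_derive_exp.
        * apply is_derive_Rscal; exact (is_derive_id s).
      + apply is_derive_Rplus; [apply is_derive_dot; apply Hd, Hs | apply is_derive_Rconst].
    - unfold scal; simpl; unfold mult; simpl; vec_ring. }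
  destruct (MVT_gen g 0 X
    (fun s => exp (- sg * s) * (2 * dot (d s) (r s) - sg * (dot (d s) (d s) + e))))
    as [c [Hc E]].
  - intros s Hs; apply Dg, Hin; lra.
  - intros s Hs; exact (is_derive_continuity_pt g s _ (Dg s (Hin s Hs))).
  - specialize (Hr c (Hin c Hc)).
    (* This is |d - k r|^2 >= 0 for k = 1 or -1. *)
    assert (Hw : forall k, k * k = 1 -> k * (2 * dot (d c) (r c)) <= dot (d c) (d c) + e).
    { intros k Hk.
      assert (H : dot (vadd (d c) (vscal (- k) (r c))) (vadd (d c) (vscal (- k) (r c)))
        = dot (d c) (d c) + k * k * dot (r c) (r c) - k * (2 * dot (d c) (r c))) by vec_ring.
      rewrite Hk in H; generalize (dot_nonneg (vadd (d c) (vscal (- k) (r c)))); lra. }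
    assert (HgX : g X <= g 0).
    { assert (Ex : X = sg * Rabs X) by (rewrite <- HX, <- Rmult_assoc, Hsg; ring).
      assert (g X - g 0 = exp (- sg * c) * Rabs X *
        (sg * (2 * dot (d c) (r c)) - sg * sg * (dot (d c) (d c) + e))).
      { rewrite E, Rminus_0_r; rewrite Ex at 1; ring. }
      specialize (Hw sg Hsg); rewrite Hsg in H.
      generalize (exp_pos (- sg * c)) (Rabs_pos X); intros P1 P2.
      assert (0 <= exp (- sg * c) * Rabs X) by nra; nra. }
    unfold g in HgX; rewrite Rmult_0_r, exp_0, Rmult_1_l in HgX.
    replace (- sg * X) with (- Rabs X) in HgX by (rewrite <- HX; ring).
    generalize (exp_pos (Rabs X)) (exp_plus (Rabs X) (- Rabs X)).
    rewrite Rplus_opp_r, exp_0; intros P1 P2.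
    apply (Rmult_le_compat_l (exp (Rabs X))) in HgX; [|lra].
    rewrite <- Rmult_assoc, <- P2, Rmult_1_l in HgX; lra.
Qed.

(** The first-order Taylor remainder with candidate derivative d. Differentiability becomes
    |[vrem]|^2 = o(h^2), a form that involves only [dot] and fits the Gronwall estimate. *)
Definition vrem (u : R -> V3) (y : R) (d : V3) (h : R) : V3 :=
  vadd (vadd (u (y + h)) (vopp (u y))) (vopp (vscal h d)).

(** Each squared component is at most e^2 h^2 <= e h^2 because e <= 1; the three of them give 3 e.
    This is the source of the choice e = min (1, eps / 3) in its applications. *)
Lemma dot_small (a : V3) (e eps h : R) :
  0 <= e <= 1 -> 3 * e <= eps ->
  Rabs (c1 a) <= e * Rabs h -> Rabs (c2 a) <= e * Rabs h -> Rabs (c3 a) <= e * Rabs h ->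
  dot a a <= eps * (h * h).
Proof.
  intros He Heps H1 H2 H3.
  assert (S : forall b, Rabs b <= e * Rabs h -> b * b <= e * (h * h)).
  { intros b Hb.
    assert (Eb : b * b = Rabs b * Rabs b) by (rewrite <- Rabs_mult, Rabs_pos_eq; nra).
    assert (Eh : h * h = Rabs h * Rabs h) by (rewrite <- Rabs_mult, Rabs_pos_eq; nra).
    generalize (Rabs_pos b) (Rabs_pos h); intros P1 P2.
    assert (Rabs b * Rabs b <= (e * Rabs h) * (e * Rabs h)) by (apply Rmult_le_compat; lra).
    assert (e * e <= e) by nra.
    assert (0 <= Rabs h * Rabs h) by nra.
    rewrite Eb, Eh; nra. }
  apply S in H1; apply S in H2; apply S in H3.
  unfold dot; assert (0 <= h * h) by nra; nra.
Qed.

Lemma is_derive_bound (f : R -> R) (y l e : R) :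
  is_derive f y l -> 0 < e ->
  exists delta, 0 < delta /\
    forall h, Rabs h < delta -> Rabs (f (y + h) - f y - h * l) <= e * Rabs h.
Proof.
  intros H He; apply is_derive_Reals in H; destruct (H e He) as [delta Hd].
  exists delta; split; [apply cond_pos|]; intros h Hh.
  destruct (Req_dec h 0) as [-> | Hn].
  - rewrite Rplus_0_r, Rabs_R0.
    replace (f y - f y - 0 * l) with 0 by ring; rewrite Rabs_R0; lra.
  - replace (f (y + h) - f y - h * l) with (((f (y + h) - f y) / h - l) * h) by (field; exact Hn).
    rewrite Rabs_mult; apply Rmult_le_compat_r; [apply Rabs_pos|].
    left; now apply Hd.
Qed.

Lemma is_vderive_bound (u : R -> V3) (y eps : R) (d : V3) :
  is_vderive u y d -> 0 < eps ->
  exists delta, 0 < delta /\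
    forall h, Rabs h < delta -> dot (vrem u y d h) (vrem u y d h) <= eps * (h * h).
Proof.
  intros (H1 & H2 & H3) He.
  pose (e := Rmin 1 (eps / 3)).
  assert (He0 : 0 < e) by (unfold e; apply Rmin_glb_lt; lra).
  assert (He1 : e <= 1) by apply Rmin_l.
  assert (He3 : e <= eps / 3) by apply Rmin_r.
  destruct (is_derive_bound _ _ _ e H1 He0) as (d1 & P1 & B1).
  destruct (is_derive_bound _ _ _ e H2 He0) as (d2 & P2 & B2).
  destruct (is_derive_bound _ _ _ e H3 He0) as (d3 & P3 & B3).
  exists (Rmin d1 (Rmin d2 d3)); split; [repeat apply Rmin_glb_lt; assumption|].
  intros h Hh.
  generalize (Rmin_l d1 (Rmin d2 d3)) (Rmin_r d1 (Rmin d2 d3)) (Rmin_l d2 d3) (Rmin_r d2 d3).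
  intros; apply (dot_small _ e); [lra | lra | | |]; unfold vrem, vopp, vadd, vscal; cbn [c1 c2 c3].
  - eapply Rle_trans; [|apply B1; lra]; right; f_equal; ring.
  - eapply Rle_trans; [|apply B2; lra]; right; f_equal; ring.
  - eapply Rle_trans; [|apply B3; lra]; right; f_equal; ring.
Qed.

Lemma is_vderive_of_bound (u : R -> V3) (y : R) (d : V3) :
  (forall eps, 0 < eps -> exists delta, 0 < delta /\
    forall h, Rabs h < delta -> dot (vrem u y d h) (vrem u y d h) <= eps * (h * h)) ->
  is_vderive u y d.
Proof.
  intros H.
  assert (Gen : forall (f : R -> R) (l : R),
    (forall h, (f (y + h) - f y - h * l) * (f (y + h) - f y - h * l)
       <= dot (vrem u y d h) (vrem u y d h)) -> is_derive f y l).
  { intros f l Hf; apply is_derive_Reals; intros eps He.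
    (* The squared error of the difference quotient is then at most eps^2 / 4, and the quotient
       itself errs by at most eps / 2 < eps. *)
    destruct (H (eps * eps / 4)) as (delta & Hd & HB); [nra|].
    exists (mkposreal delta Hd); intros h Hn Hh; simpl in Hh.
    specialize (HB h Hh); specialize (Hf h).
    pose (q := (f (y + h) - f y) / h - l).
    assert (Eq : f (y + h) - f y - h * l = q * h) by (unfold q; field; exact Hn).
    rewrite Eq in Hf; fold q.
    assert (0 < h * h) by nra.
    assert (q * q <= eps * eps / 4) by nra.
    apply Rabs_lt_between; nra. }
  assert (Sq : forall a, c1 a * c1 a <= dot a a /\ c2 a * c2 a <= dot a a /\ c3 a * c3 a <= dot a a).
  { intros a; unfold dot; split3; nra. }
  split3; apply Gen; intros h; destruct (Sq (vrem u y d h)) as (S1 & S2 & S3);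
    [eapply Rle_trans; [|exact S1] | eapply Rle_trans; [|exact S2] | eapply Rle_trans; [|exact S3]];
    right; unfold vrem, vopp, vadd, vscal; cbn [c1 c2 c3]; ring.
Qed.

Definition vcont2 (F : R -> R -> V3) : Prop :=
  cont2 (fun x y => c1 (F x y)) /\ cont2 (fun x y => c2 (F x y)) /\
  cont2 (fun x y => c3 (F x y)).

Lemma cont2_pt (f : R -> R -> R) (x y : R) : cont2 f -> continuity_2d_pt f x y.
Proof. intros H; apply continuity_2d_pt_filterlim, H. Qed.

(** The mean value theorem moves the question to the variation of [fy] in y, and compactness of
    [-X, X] makes its modulus of continuity at the line y = Y independent of x. *)
Lemma uniform_derive_bound (f fy : R -> R -> R) (X Y e : R) :
  (forall x y, is_derive (fun s => f x s) y (fy x y)) -> cont2 fy -> 0 < e ->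
  exists delta, 0 < delta /\ forall h x, Rabs h < delta -> Rabs x <= X ->
    Rabs (f x (Y + h) - f x Y - h * fy x Y) <= e * Rabs h.
Proof.
  intros Hf Hc He.
  destruct (uniform_continuity_2d_1d fy (- X) X Y) with (eps := mkposreal e He)
    as [delta Hd]; [intros x _; now apply cont2_pt|].
  exists delta; split; [apply cond_pos|]; intros h x Hh Hx.
  destruct (MVT_gen (f x) Y (Y + h) (fy x)) as [c [Hc' E]].
  - intros s _; apply Hf.
  - intros s _; exact (is_derive_continuity_pt _ _ _ (Hf x s)).
  - apply Rabs_le_between in Hx.
    assert (Hcy : Rabs (c - Y) <= Rabs h).
    { revert Hc'; unfold Rmin, Rmax, Rabs.
      destruct Rle_dec; repeat destruct Rcase_abs; lra. }
    assert (D : Rabs (fy x c - fy x Y) < e).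
    { generalize (cond_pos delta); intros.
      apply (Hd x Y x c); trivial; try lra.
      - assert (Rabs (c - Y) < delta) by lra.
        apply Rabs_lt_between in H0; lra.
      - rewrite Rminus_diag, Rabs_R0; lra. }
    rewrite E; replace (fy x c * (Y + h - Y) - h * fy x Y) with ((fy x c - fy x Y) * h) by ring.
    rewrite Rabs_mult; apply Rmult_le_compat_r; [apply Rabs_pos | lra].
Qed.

Lemma uniform_vderive_bound (F Fy : R -> R -> V3) (X Y eps : R) :
  (forall x y, is_vderive (fun s => F x s) y (Fy x y)) -> vcont2 Fy -> 0 < eps ->
  exists delta, 0 < delta /\ forall h x, Rabs h < delta -> Rabs x <= X ->
    dot (vrem (F x) Y (Fy x Y) h) (vrem (F x) Y (Fy x Y) h) <= eps * (h * h).
Proof.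
  intros HF (C1 & C2 & C3) He.
  pose (e := Rmin 1 (eps / 3)).
  assert (He0 : 0 < e) by (unfold e; apply Rmin_glb_lt; lra).
  assert (He1 : e <= 1) by apply Rmin_l.
  assert (He3 : e <= eps / 3) by apply Rmin_r.
  destruct (uniform_derive_bound (fun x y => c1 (F x y)) _ X Y e
    (fun x y => proj1 (HF x y)) C1 He0) as (d1 & P1 & B1).
  destruct (uniform_derive_bound (fun x y => c2 (F x y)) _ X Y e
    (fun x y => proj1 (proj2 (HF x y))) C2 He0) as (d2 & P2 & B2).
  destruct (uniform_derive_bound (fun x y => c3 (F x y)) _ X Y e
    (fun x y => proj2 (proj2 (HF x y))) C3 He0) as (d3 & P3 & B3).
  exists (Rmin d1 (Rmin d2 d3)); split; [repeat apply Rmin_glb_lt; assumption|].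
  intros h x Hh Hx.
  generalize (Rmin_l d1 (Rmin d2 d3)) (Rmin_r d1 (Rmin d2 d3)) (Rmin_l d2 d3) (Rmin_r d2 d3).
  intros; apply (dot_small _ e); [lra | lra | | |]; unfold vrem, vopp, vadd, vscal; cbn [c1 c2 c3].
  - eapply Rle_trans; [|apply (B1 h x); lra]; right; f_equal; ring.
  - eapply Rle_trans; [|apply (B2 h x); lra]; right; f_equal; ring.
  - eapply Rle_trans; [|apply (B3 h x); lra]; right; f_equal; ring.
Qed.

Definition flow2 (Om Lam : R -> R -> V3) (u0 : V3) (x y : R) : V3 :=
  rot_flow (fun s => Om s y) (rot_flow (Lam 0) u0 y) x.

Lemma cont2_slice (f : R -> R -> R) (x y : R) :
  cont2 f -> continuous (fun s => f s y) x.
Proof.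
  intros H; apply (continuous_comp_2 (fun s : R => s) (fun _ : R => y) f);
    [apply continuous_id | apply continuous_const | apply H].
Qed.

Lemma vcont2_slice (F : R -> R -> V3) (y : R) :
  vcont2 F -> vcontinuous (fun s => F s y).
Proof.
  intros (H1 & H2 & H3) x; split3;
    [exact (cont2_slice _ x y H1) | exact (cont2_slice _ x y H2) | exact (cont2_slice _ x y H3)].
Qed.

Lemma flow2_0 (Om Lam : R -> R -> V3) (u0 : V3) (y : R) :
  flow2 Om Lam u0 0 y = rot_flow (Lam 0) u0 y.
Proof. apply rot_flow_0. Qed.

Lemma flow2_derive_x (Om Lam : R -> R -> V3) (u0 : V3) (x y : R) :
  vcont2 Om ->
  is_vderive (fun s => flow2 Om Lam u0 s y) x (cross (Om x y) (flow2 Om Lam u0 x y)).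
Proof. intros HO; now apply (rot_flow_derive (fun s => Om s y)), vcont2_slice. Qed.

Lemma flow2_norm (Om Lam : R -> R -> V3) (u0 : V3) (x y : R) :
  vcont2 Om -> vcontinuous (Lam 0) ->
  dot (flow2 Om Lam u0 x y) (flow2 Om Lam u0 x y) = dot u0 u0.
Proof.
  intros HO HL; unfold flow2; rewrite rot_flow_norm; [now apply rot_flow_norm |].
  now apply vcont2_slice.
Qed.

Lemma vcontinuous_dot_bound (u : R -> V3) (X : R) :
  vcontinuous u -> exists C, 0 <= C /\ forall x, Rabs x <= X -> dot (u x) (u x) <= C.
Proof.
  intros Hu; destruct (vcontinuous_bound u X Hu) as (M & HM & HB).
  exists (3 * (M * M)); split; [nra|]; intros x Hx.
  destruct (HB x Hx) as (B1 & B2 & B3).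
  apply Rabs_le_between in B1; apply Rabs_le_between in B2; apply Rabs_le_between in B3.
  unfold dot; nra.
Qed.

Lemma vrem_add (u : R -> V3) (y : R) (d : V3) (h : R) :
  vadd (u (y + h)) (vopp (u y)) = vadd (vrem u y d h) (vscal h d).
Proof. unfold vrem; vec_ring. Qed.

(* Flatness makes the x-derivative of the error U (x, y+h) - U (x, y) - h (Lam x U) equal to
   Om x error up to a remainder of size o(h), so the error stays o(h) along the x-lines. *)
Lemma flow2_derive_y (Om Lam OmY LamX : R -> R -> V3) (u0 : V3) (X Y : R) :
  vcont2 Om -> vcont2 OmY -> vcontinuous (Lam 0) ->
  (forall x y, is_vderive (fun s => Om x s) y (OmY x y)) ->
  (forall x y, is_vderive (fun s => Lam s y) x (LamX x y)) ->
  (forall x y, LamX x y = vadd (OmY x y) (cross (Om x y) (Lam x y))) ->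
  is_vderive (fun s => flow2 Om Lam u0 X s) Y (cross (Lam X Y) (flow2 Om Lam u0 X Y)).
Proof.
  intros HO HOY HL DO DL Flat.
  pose (U := flow2 Om Lam u0); fold U.
  change (is_vderive (U X) Y (cross (Lam X Y) (U X Y))).
  pose (N := dot u0 u0).
  assert (HN0 : 0 <= N) by apply dot_nonneg.
  assert (HN : forall x y, dot (U x y) (U x y) = N) by (intros; now apply flow2_norm).
  assert (DUx : forall x y, is_vderive (fun s => U s y) x (cross (Om x y) (U x y)))
    by (intros; now apply flow2_derive_x).
  pose (d0 := cross (Lam 0 Y) (U 0 Y)).
  assert (DU0 : is_vderive (U 0) Y d0).
  { unfold d0, U; rewrite flow2_0.
    replace (flow2 Om Lam u0 0) with (rot_flow (Lam 0) u0)
      by (apply functional_extensionality; intros y; now rewrite flow2_0).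
    now apply rot_flow_derive. }
  destruct (vcontinuous_dot_bound (fun s => OmY s Y) (Rabs X)) as (C & HC0 & HC);
    [now apply vcont2_slice|].
  pose (E := exp (Rabs X)); assert (HE : 0 < E) by apply exp_pos.
  assert (HEx : forall x, Rabs x <= Rabs X -> exp (Rabs x) <= E).
  { intros x [Hx| ->]; [left; now apply exp_increasing | unfold E; lra]. }
  pose (D := dot d0 d0); assert (HD : 0 <= D) by apply dot_nonneg.
  (* E Q h^2 will bound |U (x, Y + h) - U (x, Y)|^2: the part 2 + 2 D comes from the line x = 0, the
     part 2 (1 + C) N from the change of the field, both with remainders e0, e1 <= 1. *)
  pose (Q := 2 + 2 * D + 2 * (1 + C) * N).
  assert (HQ : 0 <= Q) by (unfold Q; nra).
  apply is_vderive_of_bound; intros eps Heps.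
  (* A third of eps goes to each contribution to the final error: e0 to the initial error on x = 0,
     e1 to the Taylor remainder of Om, e2 to the increment of U, through h^2 <= e2. Adding 1 to N
     and to C (E Q) keeps the denominators positive. *)
  pose (e0 := Rmin 1 (eps / (3 * E))).
  pose (e1 := Rmin 1 (eps / (6 * E * (N + 1)))).
  pose (e2 := eps / (6 * E * (C * (E * Q) + 1))).
  assert (HCEQ : 0 <= C * (E * Q)) by (apply Rmult_le_pos; [|apply Rmult_le_pos]; lra).
  assert (He0 : 0 < e0).
  { apply Rmin_glb_lt; [lra | apply Rdiv_lt_0_compat; nra]. }
  assert (He1 : 0 < e1).
  { apply Rmin_glb_lt; [lra | apply Rdiv_lt_0_compat; [lra|]; apply Rmult_lt_0_compat; lra]. }
  assert (He2 : 0 < e2).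
  { apply Rdiv_lt_0_compat; [lra|]; apply Rmult_lt_0_compat; lra. }
  assert (Be0 : e0 <= 1) by apply Rmin_l.
  assert (Be1 : e1 <= 1) by apply Rmin_l.
  assert (Ce0 : 3 * (E * e0) <= eps).
  { assert (e0 <= eps / (3 * E)) by apply Rmin_r.
    apply Rle_div_r in H; lra. }
  assert (Ce1 : 6 * (E * (e1 * N)) <= eps).
  { assert (e1 <= eps / (6 * E * (N + 1))) by apply Rmin_r.
    apply Rle_div_r in H; [|apply Rmult_lt_0_compat; lra].
    assert (0 < E * e1) by nra; lra. }
  assert (Ce2 : 6 * (E * (C * (E * Q) * e2)) <= eps).
  { assert (H : e2 <= eps / (6 * E * (C * (E * Q) + 1))) by (unfold e2; lra).
    apply Rle_div_r in H; [|apply Rmult_lt_0_compat; lra].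
    assert (0 < E * e2) by nra; lra. }
  destruct (is_vderive_bound (U 0) Y e0 d0 DU0 He0) as (t0 & Ht0 & B0).
  destruct (uniform_vderive_bound Om OmY (Rabs X) Y e1 DO HOY He1) as (t1 & Ht1 & B1).
  exists (Rmin (Rmin 1 e2) (Rmin t0 t1)); split;
    [repeat apply Rmin_glb_lt; lra|].
  intros h Hh.
  assert (Hh1 : Rabs h < 1 /\ Rabs h < e2 /\ Rabs h < t0 /\ Rabs h < t1).
  { generalize (Rmin_l (Rmin 1 e2) (Rmin t0 t1)) (Rmin_r (Rmin 1 e2) (Rmin t0 t1))
      (Rmin_l 1 e2) (Rmin_r 1 e2) (Rmin_l t0 t1) (Rmin_r t0 t1); lra. }
  destruct Hh1 as (Hh1 & Hh2 & Hh3 & Hh4).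
  assert (Hhh : 0 <= h * h) by nra.
  assert (Hh5 : h * h <= e2).
  { replace (h * h) with (Rabs h * Rabs h) by (rewrite <- Rabs_mult, Rabs_pos_eq; nra).
    generalize (Rabs_pos h); nra. }
  specialize (B0 h Hh3).
  pose (eta s := vadd (U s (Y + h)) (vopp (U s Y))).
  assert (Heta : forall x, Rabs x <= Rabs X -> dot (eta x) (eta x) <= E * Q * (h * h)).
  { intros x Hx.
    (* First Gronwall pass: the increment [eta] satisfies the same equation with the source (Om (Y +
       h) - Om (Y)) x U (Y + h), which is O(h); hence [eta] = O(h). *)
    pose (r s := cross (vadd (Om s (Y + h)) (vopp (Om s Y))) (U s (Y + h))).
    assert (G : dot (eta x) (eta x)
      <= exp (Rabs x) * (dot (eta 0) (eta 0) + 2 * (1 + C) * N * (h * h))).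
    { apply (rot_gronwall (fun s => Om s Y) eta r).
      - intros s Hs; eapply is_vderive_eq.
        + apply is_vderive_vadd; [apply DUx | apply is_vderive_vscal, DUx].
        + unfold r, eta; vec_ring.
      - intros s Hs; eapply Rle_trans; [apply dot_cross_le|]; rewrite HN.
        rewrite (vrem_add (Om s) Y (OmY s Y) h).
        assert (dot (vadd (vrem (Om s) Y (OmY s Y) h) (vscal h (OmY s Y)))
          (vadd (vrem (Om s) Y (OmY s Y) h) (vscal h (OmY s Y))) <= 2 * (1 + C) * (h * h)).
        { eapply Rle_trans; [apply dot_vadd_le|]; rewrite dot_vscal.
          specialize (B1 h s Hh4 (Rle_trans _ _ _ Hs Hx)).
          specialize (HC s (Rle_trans _ _ _ Hs Hx)); simpl in HC.
          assert (e1 * (h * h) <= 1 * (h * h)) by (apply Rmult_le_compat_r; lra).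
          assert (h * h * dot (OmY s Y) (OmY s Y) <= h * h * C)
            by (apply Rmult_le_compat_l; lra).
          lra. }
        replace (2 * (1 + C) * N * (h * h)) with (2 * (1 + C) * (h * h) * N) by ring.
        now apply Rmult_le_compat_r. }
    assert (G0 : dot (eta 0) (eta 0) <= (2 + 2 * D) * (h * h)).
    { unfold eta; rewrite (vrem_add (U 0) Y d0 h).
      eapply Rle_trans; [apply dot_vadd_le|]; rewrite dot_vscal; fold D.
      assert (e0 * (h * h) <= 1 * (h * h)) by (apply Rmult_le_compat_r; lra).
      lra. }
    eapply Rle_trans; [exact G|].
    rewrite (Rmult_assoc E); apply Rmult_le_compat.
    - left; apply exp_pos.
    - generalize (dot_nonneg (eta 0)); intros.
      assert (0 <= 2 * (1 + C) * N * (h * h)) by (apply Rmult_le_pos; [apply Rmult_le_pos; lra | exact Hhh]); lra.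
    - now apply HEx.
    - unfold Q; lra. }
  pose (dl s := vrem (U s) Y (cross (Lam s Y) (U s Y)) h).
  (* Second pass. By flatness and the Jacobi identity, the x-derivative of Lam x U is OmY x U + Om x
     (Lam x U), so the error has a source made only of the remainder of Om, which is o(h), and of h
     OmY x [eta], which is O(h^2). *)
  pose (r s := vadd (cross (vrem (Om s) Y (OmY s Y) h) (U s (Y + h)))
                    (vscal h (cross (OmY s Y) (eta s)))).
  assert (G : dot (dl X) (dl X) <= E * (dot (dl 0) (dl 0)
    + (2 * (e1 * N) + 2 * (C * (E * Q) * e2)) * (h * h))).
  { apply (rot_gronwall (fun s => Om s Y) dl r).
    - intros s Hs; unfold dl, vrem; eapply is_vderive_eq.
      + apply is_vderive_vadd;
          [apply is_vderive_vadd; [apply DUx | apply is_vderive_vscal, DUx]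
          | apply is_vderive_vscal, is_vderive_vscal, is_vderive_cross; [apply DL | apply DUx]].
      + cbv beta; rewrite Flat; unfold r, eta, vrem; vec_ring.
    - intros s Hs; eapply Rle_trans; [apply dot_vadd_le|]; rewrite dot_vscal.
      assert (A1 : dot (cross (vrem (Om s) Y (OmY s Y) h) (U s (Y + h)))
         (cross (vrem (Om s) Y (OmY s Y) h) (U s (Y + h))) <= e1 * (h * h) * N).
      { eapply Rle_trans; [apply dot_cross_le|]; rewrite HN.
        apply Rmult_le_compat_r; [exact HN0 | now apply B1]. }
      assert (A2 : dot (cross (OmY s Y) (eta s)) (cross (OmY s Y) (eta s)) <= C * (E * Q) * e2).
      { eapply Rle_trans; [apply dot_cross_le|]; rewrite Rmult_assoc.
        apply Rmult_le_compat; try apply dot_nonneg; [now apply HC|].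
        eapply Rle_trans; [now apply Heta|]; apply Rmult_le_compat_l; [apply Rmult_le_pos; lra | exact Hh5]. }
      assert (h * h * dot (cross (OmY s Y) (eta s)) (cross (OmY s Y) (eta s))
        <= h * h * (C * (E * Q) * e2)) by (apply Rmult_le_compat_l; lra).
      lra. }
  fold (dl X); eapply Rle_trans; [exact G|].
  assert (G0 : dot (dl 0) (dl 0) <= e0 * (h * h)) by exact B0.
  replace (eps * (h * h)) with (eps / 3 * (h * h) + eps / 3 * (h * h) + eps / 3 * (h * h)) by field.
  assert (E * dot (dl 0) (dl 0) <= E * (e0 * (h * h))) by (apply Rmult_le_compat_l; lra).
  assert (E * e0 * (h * h) <= eps / 3 * (h * h)) by (apply Rmult_le_compat_r; lra).
  assert (E * (2 * (e1 * N)) * (h * h) <= eps / 3 * (h * h)) by (apply Rmult_le_compat_r; lra).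
  assert (E * (2 * (C * (E * Q) * e2)) * (h * h) <= eps / 3 * (h * h))
    by (apply Rmult_le_compat_r; lra).
  lra.
Qed.

(** * Functions of two variables *)

Lemma cont2_intro (f : R -> R -> R) :
  (forall x y eps, 0 < eps -> exists delta, 0 < delta /\
    forall x' y', Rabs (x' - x) < delta -> Rabs (y' - y) < delta ->
      Rabs (f x' y' - f x y) < eps) -> cont2 f.
Proof.
  intros H x y; apply (proj1 (continuity_2d_pt_filterlim f x y)); intros eps.
  destruct (H x y eps (cond_pos eps)) as (d & Hd & B).
  exists (mkposreal d Hd); exact B.
Qed.

Lemma cont2_plus (f g : R -> R -> R) :
  cont2 f -> cont2 g -> cont2 (fun x y => f x y + g x y).
Proof. intros Hf Hg x y; exact (continuous_plus _ _ _ (Hf x y) (Hg x y)). Qed.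

Lemma cont2_minus (f g : R -> R -> R) :
  cont2 f -> cont2 g -> cont2 (fun x y => f x y - g x y).
Proof. intros Hf Hg x y; exact (continuous_minus _ _ _ (Hf x y) (Hg x y)). Qed.

Lemma cont2_mult (f g : R -> R -> R) :
  cont2 f -> cont2 g -> cont2 (fun x y => f x y * g x y).
Proof. intros Hf Hg x y; exact (continuous_mult _ _ _ (Hf x y) (Hg x y)). Qed.

Lemma cont2_const (c : R) : cont2 (fun _ _ => c).
Proof. intros x y; apply continuous_const. Qed.

Lemma cont2_comp (k dk : R -> R) (f : R -> R -> R) :
  (forall s, is_derive k s (dk s)) -> cont2 f -> cont2 (fun x y => k (f x y)).
Proof.
  intros Hk Hf x y.
  apply (continuous_comp (fun p : R * R => f (fst p) (snd p)) k); [apply Hf|].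
  apply (ex_derive_continuous (K := R_AbsRing) (V := R_NormedModule)); eexists; apply Hk.
Qed.

Lemma cont2_opp (f : R -> R -> R) : cont2 f -> cont2 (fun x y => - f x y).
Proof. intros Hf x y; exact (continuous_opp _ _ (Hf x y)). Qed.

Lemma cont2_locally_bounded (f : R -> R -> R) (x y : R) :
  cont2 f -> exists M delta, 0 <= M /\ 0 < delta /\
    forall x' y', Rabs (x' - x) < delta -> Rabs (y' - y) < delta -> Rabs (f x' y') <= M.
Proof.
  intros H; destruct (cont2_pt f x y H (mkposreal 1 Rlt_0_1)) as [d Hd].
  exists (Rabs (f x y) + 1), d; generalize (Rabs_pos (f x y)); intros P.
  split; [lra|]; split; [apply cond_pos|]; intros x' y' Hx Hy.
  specialize (Hd x' y' Hx Hy); simpl in Hd.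
  replace (f x' y') with (f x y + (f x' y' - f x y)) by ring.
  eapply Rle_trans; [apply Rabs_triang | lra].
Qed.

(** The partials are named as functions on the whole plane, so that extensionality replaces [pdx f]
    and [pdy f] by them even under a second derivative. *)
Definition has_partials (f fx fy : R -> R -> R) : Prop :=
  forall x y, is_derive (fun s => f s y) x (fx x y) /\ is_derive (fun s => f x s) y (fy x y).

Lemma has_partials_pdx (f fx fy : R -> R -> R) : has_partials f fx fy -> pdx f = fx.
Proof.
  intros H; apply functional_extensionality; intros x; apply functional_extensionality; intros y.
  apply is_derive_unique, H.
Qed.

Lemma has_partials_pdy (f fx fy : R -> R -> R) : has_partials f fx fy -> pdy f = fy.
Proof.
  intros H; apply functional_extensionality; intros x; apply functional_extensionality; intros y.
  apply is_derive_unique, H.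
Qed.

Lemma has_partials_minus (f fx fy g gx gy : R -> R -> R) :
  has_partials f fx fy -> has_partials g gx gy ->
  has_partials (fun x y => f x y - g x y)
    (fun x y => fx x y - gx x y) (fun x y => fy x y - gy x y).
Proof. intros Hf Hg x y; destruct (Hf x y), (Hg x y); split; now apply is_derive_Rminus. Qed.

Lemma has_partials_mult (f fx fy g gx gy : R -> R -> R) :
  has_partials f fx fy -> has_partials g gx gy ->
  has_partials (fun x y => f x y * g x y)
    (fun x y => fx x y * g x y + f x y * gx x y) (fun x y => fy x y * g x y + f x y * gy x y).
Proof.
  intros Hf Hg x y; split.
  - apply (is_derive_Rmult (fun s => f s y) (fun s => g s y)); [apply Hf | apply Hg].
  - apply (is_derive_Rmult (fun s => f x s) (fun s => g x s)); [apply Hf | apply Hg].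
Qed.

Lemma has_partials_scal_comp (a : R) (k dk : R -> R) (f fx fy : R -> R -> R) :
  (forall s, is_derive k s (dk s)) -> has_partials f fx fy ->
  has_partials (fun x y => a * k (f x y))
    (fun x y => a * (fx x y * dk (f x y))) (fun x y => a * (fy x y * dk (f x y))).
Proof.
  intros Hk Hf x y; split; apply is_derive_Rscal.
  - apply (is_derive_comp k (fun s => f s y)); [apply Hk | apply Hf].
  - apply (is_derive_comp k (fun s => f x s)); [apply Hk | apply Hf].
Qed.

Lemma C2_partials (f : R -> R -> R) : C2 f ->
  has_partials f (pdx f) (pdy f) /\
  has_partials (pdx f) (pdx (pdx f)) (pdy (pdx f)) /\
  has_partials (pdy f) (pdx (pdy f)) (pdy (pdy f)).
Proof.
  intros (H1 & H2 & _); split3; intros x y;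
    destruct (H1 x y) as (? & ?), (H2 x y) as (? & ? & ? & ?);
    split; apply Derive_correct; assumption.
Qed.

Lemma C2_intro (f fx fy fxx fxy fyx fyy : R -> R -> R) :
  has_partials f fx fy -> has_partials fx fxx fxy -> has_partials fy fyx fyy ->
  cont2 f -> cont2 fx -> cont2 fy -> cont2 fxx -> cont2 fxy -> cont2 fyx -> cont2 fyy -> C2 f.
Proof.
  intros H Hx Hy; intros.
  unfold C2.
  rewrite (has_partials_pdx _ _ _ H), (has_partials_pdy _ _ _ H).
  rewrite (has_partials_pdx _ _ _ Hx), (has_partials_pdy _ _ _ Hx).
  rewrite (has_partials_pdx _ _ _ Hy), (has_partials_pdy _ _ _ Hy).
  split; [intros x y; destruct (H x y); split; eexists; eassumption|].
  split; [|repeat (split; [assumption|]); assumption].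
  intros x y; destruct (Hx x y), (Hy x y).
  split; [|split3]; eexists; eassumption.
Qed.

(** A locally bounded x-derivative makes f Lipschitz in x with one constant for all nearby y; along
    the single line through the point, differentiability in y gives continuity. No continuity of the
    partials enters, which avoids a circle for flows whose partials contain the flow itself. *)
Lemma cont2_of_partials (f fx fy : R -> R -> R) :
  has_partials f fx fy ->
  (forall x y, exists M delta, 0 <= M /\ 0 < delta /\
    forall x' y', Rabs (x' - x) < delta -> Rabs (y' - y) < delta -> Rabs (fx x' y') <= M) ->
  cont2 f.
Proof.
  intros Hf HB; apply cont2_intro; intros x y eps Heps.
  destruct (HB x y) as (M & d & HM & Hd & B).
  assert (Hc : continuity_pt (fun s => f x s) y) by exact (is_derive_continuity_pt (fun s => f x s) y _ (proj2 (Hf x y))).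
  destruct (Hc (eps / 2)) as (d' & Hd' & B'); [lra|].
  exists (Rmin d (Rmin d' (eps / (2 * (M + 1))))); split.
  { repeat apply Rmin_glb_lt; trivial; apply Rdiv_lt_0_compat; lra. }
  intros x' y' Hx Hy.
  generalize (Rmin_l d (Rmin d' (eps / (2 * (M + 1))))) (Rmin_r d (Rmin d' (eps / (2 * (M + 1)))))
    (Rmin_l d' (eps / (2 * (M + 1)))) (Rmin_r d' (eps / (2 * (M + 1)))); intros.
  assert (A1 : Rabs (f x y' - f x y) < eps / 2).
  { destruct (Req_dec y' y) as [-> | Hn]; [rewrite Rminus_diag, Rabs_R0; lra|].
    apply B'; split; [split; [exact I | congruence]|]; simpl; unfold Rdist; lra. }
  assert (A2 : Rabs (f x' y' - f x y') <= M * Rabs (x' - x)).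
  { destruct (MVT_gen (fun s => f s y') x x' (fun s => fx s y')) as [c [Hc' E]].
    - intros s _; apply Hf.
    - intros s _; exact (is_derive_continuity_pt (fun s => f s y') s _ (proj1 (Hf s y'))).
    - rewrite E, Rabs_mult; apply Rmult_le_compat_r; [apply Rabs_pos|].
      apply B; [|lra].
      apply Rle_lt_trans with (Rabs (x' - x)); [|lra].
      revert Hc'; unfold Rmin, Rmax, Rabs; destruct Rle_dec; repeat destruct Rcase_abs; lra. }
  replace (f x' y' - f x y) with ((f x' y' - f x y') + (f x y' - f x y)) by ring.
  eapply Rle_lt_trans; [apply Rabs_triang|].
  assert (A3 : Rabs (x' - x) < eps / (2 * (M + 1))) by lra.
  apply Rlt_div_r in A3; [|lra].
  generalize (Rabs_pos (x' - x)); nra.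
Qed.

(** * Flat sections: continuity and algebra *)

Definition flat_section (Om Lam u : R -> R -> V3) : Prop :=
  vcont2 u /\ forall x y,
    is_vderive (fun s => u s y) x (cross (Om x y) (u x y)) /\
    is_vderive (fun s => u x s) y (cross (Lam x y) (u x y)).

Lemma flat_section_partials (Om Lam u : R -> R -> V3) :
  flat_section Om Lam u ->
  has_partials (fun x y => c1 (u x y))
    (fun x y => c1 (cross (Om x y) (u x y))) (fun x y => c1 (cross (Lam x y) (u x y))) /\
  has_partials (fun x y => c2 (u x y))
    (fun x y => c2 (cross (Om x y) (u x y))) (fun x y => c2 (cross (Lam x y) (u x y))) /\
  has_partials (fun x y => c3 (u x y))
    (fun x y => c3 (cross (Om x y) (u x y))) (fun x y => c3 (cross (Lam x y) (u x y))).
Proof.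
  intros [_ H]; split3; intros x y; destruct (H x y) as [(X1 & X2 & X3) (Y1 & Y2 & Y3)];
    split; assumption.
Qed.

Lemma flow2_flat_section (Om Lam OmY LamX : R -> R -> V3) (u0 : V3) :
  vcont2 Om -> vcont2 OmY -> vcontinuous (Lam 0) ->
  (forall x y, is_vderive (fun s => Om x s) y (OmY x y)) ->
  (forall x y, is_vderive (fun s => Lam s y) x (LamX x y)) ->
  (forall x y, LamX x y = vadd (OmY x y) (cross (Om x y) (Lam x y))) ->
  flat_section Om Lam (flow2 Om Lam u0).
Proof.
  intros HO HOY HL DO DL Flat.
  assert (D : forall x y,
    is_vderive (fun s => flow2 Om Lam u0 s y) x (cross (Om x y) (flow2 Om Lam u0 x y)) /\
    is_vderive (fun s => flow2 Om Lam u0 x s) y (cross (Lam x y) (flow2 Om Lam u0 x y))).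
  { intros x y; split; [now apply flow2_derive_x | now apply flow2_derive_y with OmY LamX]. }
  split; [|exact D].
  pose (N := dot u0 u0).
  assert (HU : forall x y, let u := flow2 Om Lam u0 x y in
    Rabs (c1 u) <= N + 1 /\ Rabs (c2 u) <= N + 1 /\ Rabs (c3 u) <= N + 1).
  { intros x y u.
    assert (Hu : dot u u = N) by now apply flow2_norm.
    revert Hu; unfold dot; intros Hu; split3; apply Rabs_le; nra. }
  (* The x-derivative of a component is a component of Om x u: Om is locally bounded by continuity,
     and u is bounded because its norm is constant. *)
  assert (Gen : forall f g h k fy : R -> R -> R, forall F : R -> R -> R,
    cont2 f -> cont2 h ->
    (forall x y, Rabs (g x y) <= N + 1) -> (forall x y, Rabs (k x y) <= N + 1) ->
    has_partials F (fun x y => f x y * g x y - h x y * k x y) fy -> cont2 F).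
  { intros f g h k fy F Cf Ch Bg Bk HF; apply (cont2_of_partials _ _ _ HF); intros x y.
    destruct (cont2_locally_bounded f x y Cf) as (M1 & d1 & P1 & Q1 & B1).
    destruct (cont2_locally_bounded h x y Ch) as (M2 & d2 & P2 & Q2 & B2).
    exists (2 * (M1 + M2) * (N + 1)), (Rmin d1 d2).
    assert (HN : 0 <= N) by apply dot_nonneg.
    split; [apply Rmult_le_pos; lra|]; split; [now apply Rmin_glb_lt|].
    intros x' y' Hx Hy; generalize (Rmin_l d1 d2) (Rmin_r d1 d2); intros.
    assert (Rabs (f x' y') <= M1) by (apply B1; lra).
    assert (Rabs (h x' y') <= M2) by (apply B2; lra).
    apply Rabs_cross_sub_le; trivial; lra. }
  destruct HO as (HO1 & HO2 & HO3).
  split3.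
  - apply (Gen (fun x y => c2 (Om x y)) (fun x y => c3 (flow2 Om Lam u0 x y))
      (fun x y => c3 (Om x y)) (fun x y => c2 (flow2 Om Lam u0 x y))
      (fun x y => c1 (cross (Lam x y) (flow2 Om Lam u0 x y)))); trivial; try (intros; apply HU).
    intros x y; destruct (D x y) as [(X1 & X2 & X3) (Y1 & Y2 & Y3)]; split; assumption.
  - apply (Gen (fun x y => c3 (Om x y)) (fun x y => c1 (flow2 Om Lam u0 x y))
      (fun x y => c1 (Om x y)) (fun x y => c3 (flow2 Om Lam u0 x y))
      (fun x y => c2 (cross (Lam x y) (flow2 Om Lam u0 x y)))); trivial; try (intros; apply HU).
    intros x y; destruct (D x y) as [(X1 & X2 & X3) (Y1 & Y2 & Y3)]; split; assumption.
  - apply (Gen (fun x y => c1 (Om x y)) (fun x y => c2 (flow2 Om Lam u0 x y))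
      (fun x y => c2 (Om x y)) (fun x y => c1 (flow2 Om Lam u0 x y))
      (fun x y => c3 (cross (Lam x y) (flow2 Om Lam u0 x y)))); trivial; try (intros; apply HU).
    intros x y; destruct (D x y) as [(X1 & X2 & X3) (Y1 & Y2 & Y3)]; split; assumption.
Qed.

(** By the Jacobi identity, u -> Om x u is a derivation of the cross product. This supplies the
    third coordinate of the frame. *)
Lemma flat_section_cross (Om Lam a b : R -> R -> V3) :
  flat_section Om Lam a -> flat_section Om Lam b ->
  flat_section Om Lam (fun x y => cross (a x y) (b x y)).
Proof.
  intros [(A1 & A2 & A3) DA] [(B1 & B2 & B3) DB]; split.
  - split3; cbn [cross c1 c2 c3]; apply cont2_minus; now apply cont2_mult.
  - intros x y; destruct (DA x y) as [AX AY], (DB x y) as [BX BY]; split.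
    + eapply is_vderive_eq; [exact (is_vderive_cross _ _ _ _ _ AX BX) | cbv beta; vec_ring].
    + eapply is_vderive_eq; [exact (is_vderive_cross _ _ _ _ _ AY BY) | cbv beta; vec_ring].
Qed.

(** Rotation fields are skew, so the product is constant on the horizontal path to (0, y) and then
    on the vertical path to the origin. *)
Lemma flat_section_dot (Om Lam a b : R -> R -> V3) (x y : R) :
  flat_section Om Lam a -> flat_section Om Lam b ->
  dot (a x y) (b x y) = dot (a 0 0) (b 0 0).
Proof.
  intros [_ DA] [_ DB].
  transitivity (dot (a 0 y) (b 0 y)).
  - apply (is_derive_zero_const (fun s => dot (a s y) (b s y))); intros s.
    eapply is_derive_eq; [exact (is_derive_dot _ _ _ _ _ (proj1 (DA s y)) (proj1 (DB s y)))
      | cbv beta; vec_ring].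
  - apply (is_derive_zero_const (fun s => dot (a 0 s) (b 0 s))); intros s.
    eapply is_derive_eq; [exact (is_derive_dot _ _ _ _ _ (proj2 (DA 0 s)) (proj2 (DB 0 s)))
      | cbv beta; vec_ring].
Qed.

(** * The frame of a sinh-Gordon solution *)

Lemma C2_opp (f : R -> R -> R) : C2 f ->
  C2 (fun x y => - f x y) /\
  forall x y, dzdzbar (fun x y => - f x y) x y = - dzdzbar f x y.
Proof.
  intros H; destruct (C2_partials f H) as (P & Px & Py).
  destruct H as (_ & _ & K & Kx & Ky & Kxx & Kxy & Kyx & Kyy).
  assert (Opp : forall g gx gy, has_partials g gx gy ->
    has_partials (fun x y => - g x y) (fun x y => - gx x y) (fun x y => - gy x y)).
  { intros g gx gy Hg x y; destruct (Hg x y) as [Gx Gy]; split;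
      [exact (is_derive_opp _ _ _ Gx) | exact (is_derive_opp _ _ _ Gy)]. }
  apply Opp in P; apply Opp in Px; apply Opp in Py; split.
  - apply (C2_intro _ _ _ _ _ _ _ P Px Py); now apply cont2_opp.
  - intros x y; unfold dzdzbar.
    rewrite (has_partials_pdx _ _ _ P), (has_partials_pdy _ _ _ P).
    rewrite (has_partials_pdx _ _ _ Px), (has_partials_pdy _ _ _ Py); ring.
Qed.

Lemma sinh_Gordon_solution_opp (w : R -> R -> R) :
  sinh_Gordon_solution w -> sinh_Gordon_solution (fun x y => - w x y).
Proof.
  intros [HC HE]; destruct (C2_opp w HC) as [HC' E]; split; [exact HC'|].
  intros x y; rewrite E; specialize (HE x y).
  replace (2 * - w x y) with (- (2 * w x y)) by ring; rewrite sinh_opp; lra.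
Qed.

Lemma cosh_double (x : R) : cosh (2 * x) = 1 + 2 * (sinh x * sinh x).
Proof.
  unfold cosh, sinh; replace (- (2 * x)) with (- x + - x) by ring.
  replace (2 * x) with (x + x) by ring; rewrite !exp_plus.
  generalize (exp_plus x (- x)); rewrite Rplus_opp_r, exp_0; intros; nra.
Qed.

Lemma sinh_double (x : R) : sinh (2 * x) = 2 * (sinh x * cosh x).
Proof.
  unfold cosh, sinh; replace (- (2 * x)) with (- x + - x) by ring.
  replace (2 * x) with (x + x) by ring; rewrite !exp_plus; field.
Qed.

(* A section [u] lists one coordinate of the three frame vectors p, e1, e2, so the rows of
   [cross (conn_x v t x y) u] are the structure equations for the x-derivatives of p, e1, e2. *)
Definition conn_x (v : R -> R -> R) (t x y : R) : V3 :=
  mkV3 (pdy v x y) (2 * sin (t / 2) * sinh (v x y)) (- 2 * cos (t / 2) * cosh (v x y)).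

Definition conn_y (v : R -> R -> R) (t x y : R) : V3 :=
  mkV3 (- pdx v x y) (2 * cos (t / 2) * sinh (v x y)) (2 * sin (t / 2) * cosh (v x y)).

Lemma conn_sinh_partials (a : R) (v : R -> R -> R) : C2 v ->
  has_partials (fun x y => a * sinh (v x y))
    (fun x y => a * (pdx v x y * cosh (v x y))) (fun x y => a * (pdy v x y * cosh (v x y))).
Proof.
  intros HC; exact (has_partials_scal_comp a _ _ _ _ _ is_derive_sinh (proj1 (C2_partials v HC))).
Qed.

Lemma conn_cosh_partials (a : R) (v : R -> R -> R) : C2 v ->
  has_partials (fun x y => a * cosh (v x y))
    (fun x y => a * (pdx v x y * sinh (v x y))) (fun x y => a * (pdy v x y * sinh (v x y))).
Proof.
  intros HC; exact (has_partials_scal_comp a _ _ _ _ _ is_derive_cosh (proj1 (C2_partials v HC))).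
Qed.

Lemma cont2_sinh (v : R -> R -> R) : cont2 v -> cont2 (fun x y => sinh (v x y)).
Proof. apply (cont2_comp sinh cosh), is_derive_sinh. Qed.

Lemma cont2_cosh (v : R -> R -> R) : cont2 v -> cont2 (fun x y => cosh (v x y)).
Proof. apply (cont2_comp cosh sinh), is_derive_cosh. Qed.

Ltac cont2_tac :=
  lazymatch goal with
  | |- cont2 (fun _ _ => ?c) => apply (cont2_const c)
  | |- cont2 (fun x y => @?f x y + @?g x y) => apply (cont2_plus f g); cont2_tac
  | |- cont2 (fun x y => @?f x y - @?g x y) => apply (cont2_minus f g); cont2_tac
  | |- cont2 (fun x y => @?f x y * @?g x y) => apply (cont2_mult f g); cont2_tac
  | |- cont2 (fun x y => - @?f x y) => apply (cont2_opp f); cont2_tac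
  | |- cont2 (fun x y => sinh (@?f x y)) => apply (cont2_sinh f); cont2_tac
  | |- cont2 (fun x y => cosh (@?f x y)) => apply (cont2_cosh f); cont2_tac
  | |- _ => assumption
  end.

Lemma vcont2_conn_x (v : R -> R -> R) (t : R) : C2 v -> vcont2 (conn_x v t).
Proof.
  intros (_ & _ & K & Kx & Ky & _); unfold conn_x; split3; cbn [c1 c2 c3]; cont2_tac.
Qed.

Lemma conn_flat_section (v : R -> R -> R) (t : R) (u0 : V3) :
  sinh_Gordon_solution v ->
  flat_section (conn_x v t) (conn_y v t) (flow2 (conn_x v t) (conn_y v t) u0).
Proof.
  intros [HC HE].
  destruct (C2_partials v HC) as (P & Px & Py).
  pose (OmY x y := mkV3 (pdy (pdy v) x y)
    (2 * sin (t / 2) * (pdy v x y * cosh (v x y)))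
    (- 2 * cos (t / 2) * (pdy v x y * sinh (v x y)))).
  pose (LamX x y := mkV3 (- pdx (pdx v) x y)
    (2 * cos (t / 2) * (pdx v x y * cosh (v x y)))
    (2 * sin (t / 2) * (pdx v x y * sinh (v x y)))).
  assert (DL : forall x y, is_vderive (fun s => conn_y v t s y) x (LamX x y)).
  { intros x y; split3; cbn [conn_y LamX c1 c2 c3].
    - exact (is_derive_opp _ _ _ (proj1 (Px x y))).
    - exact (proj1 (conn_sinh_partials _ v HC x y)).
    - exact (proj1 (conn_cosh_partials _ v HC x y)). }
  apply (flow2_flat_section _ _ OmY LamX).
  - now apply vcont2_conn_x.
  - destruct HC as (_ & _ & K & Kx & Ky & Kxx & Kxy & Kyx & Kyy).
    split3; cbn [OmY c1 c2 c3]; cont2_tac.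
  - intros y; split3; cbn [conn_y c1 c2 c3];
      apply (ex_derive_continuous (K := R_AbsRing) (V := R_NormedModule)); eexists.
    + exact (is_derive_opp _ _ _ (proj2 (Px 0 y))).
    + exact (is_derive_Rscal _ _ _ _ (is_derive_comp sinh (fun s => v 0 s) y _ _
        (is_derive_sinh _) (proj2 (P 0 y)))).
    + exact (is_derive_Rscal _ _ _ _ (is_derive_comp cosh (fun s => v 0 s) y _ _
        (is_derive_cosh _) (proj2 (P 0 y)))).
  - intros x y; split3; cbn [conn_x OmY c1 c2 c3].
    + exact (proj2 (Py x y)).
    + exact (proj2 (conn_sinh_partials _ v HC x y)).
    + exact (proj2 (conn_cosh_partials _ v HC x y)).
  - exact DL.
  - intros x y; specialize (HE x y); unfold dzdzbar in HE; rewrite sinh_double in HE.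
    generalize (sin2_cos2 (t / 2)); unfold Rsqr; intros Hsc.
    (* Only the first component carries information: it reads v_xx + v_yy + 4 sinh v cosh v = 0,
       four times the sinh-Gordon equation, and t disappears by sin^2 + cos^2 = 1. The other two are
       identities. *)
    unfold LamX, OmY, conn_x, conn_y, vadd, cross; cbn [c1 c2 c3]; f_equal; [|ring|ring].
    pose (j := sinh (v x y) * cosh (v x y)).
    transitivity (pdy (pdy v) x y + 4 * (sin (t / 2) * sin (t / 2) + cos (t / 2) * cos (t / 2)) * j).
    + rewrite Hsc; unfold j; lra.
    + unfold j; ring.
Qed.

(** The first component of a section is a coordinate of p. In its Laplacian the terms along e1 and
    e2 cancel, since the derivatives of the coefficients are compensated by the connection form;
    what remains is -|dp|^2 p, the harmonic map equation into the sphere. *)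
Lemma section_c1_harmonic (v : R -> R -> R) (t : R) (u : R -> R -> V3) :
  C2 v -> flat_section (conn_x v t) (conn_y v t) u ->
  let f x y := c1 (u x y) in
  C2 f /\ forall x y,
    pdx f x y = 2 * cos (t / 2) * cosh (v x y) * c2 (u x y)
              + 2 * sin (t / 2) * sinh (v x y) * c3 (u x y) /\
    pdy f x y = - 2 * sin (t / 2) * cosh (v x y) * c2 (u x y)
              + 2 * cos (t / 2) * sinh (v x y) * c3 (u x y) /\
    pdx (pdx f) x y + pdy (pdy f) x y = - (4 * cosh (2 * v x y)) * c1 (u x y).
Proof.
  intros HC HS f.
  destruct (flat_section_partials _ _ _ HS) as (U1 & U2 & U3).
  destruct HS as [(Ku1 & Ku2 & Ku3) _].
  pose proof (has_partials_minus _ _ _ _ _ _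
    (has_partials_mult _ _ _ _ _ _ (conn_sinh_partials (2 * sin (t / 2)) v HC) U3)
    (has_partials_mult _ _ _ _ _ _ (conn_cosh_partials (- 2 * cos (t / 2)) v HC) U2)) as Fx.
  pose proof (has_partials_minus _ _ _ _ _ _
    (has_partials_mult _ _ _ _ _ _ (conn_sinh_partials (2 * cos (t / 2)) v HC) U3)
    (has_partials_mult _ _ _ _ _ _ (conn_cosh_partials (2 * sin (t / 2)) v HC) U2)) as Fy.
  split.
  - apply (C2_intro f _ _ _ _ _ _ U1 Fx Fy);
      destruct HC as (_ & _ & K & Kx & Ky & Kxx & Kxy & Kyx & Kyy);
      unfold f; cbn [cross conn_x conn_y c1 c2 c3]; cont2_tac.
  - intros x y.
    rewrite (has_partials_pdx f _ _ U1), (has_partials_pdy f _ _ U1).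
    split3; [cbn [cross conn_x conn_y c1 c2 c3]; ring | cbn [cross conn_x conn_y c1 c2 c3]; ring |].
    pose proof (has_partials_pdx _ _ _ Fx) as Ex.
    pose proof (has_partials_pdy _ _ _ Fy) as Ey.
    apply (f_equal (fun g => g x y)) in Ex; apply (f_equal (fun g => g x y)) in Ey.
    etransitivity; [apply (f_equal2 Rplus Ex Ey)|].
    cbn [cross conn_x conn_y c1 c2 c3].
    generalize (sin2_cos2 (t / 2)) (cosh_sqr (v x y)); unfold Rsqr; intros Hsc Hcs.
    rewrite cosh_double.
    transitivity (- (4 * (sin (t / 2) * sin (t / 2) + cos (t / 2) * cos (t / 2))
      * (sinh (v x y) * sinh (v x y) + cosh (v x y) * cosh (v x y))) * c1 (u x y)).
    + ring.
    + rewrite Hsc, Hcs; ring.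
Qed.

(** The sections [g1], [g2] and their cross product are the columns of a matrix that is the identity
    at the origin; its rows are p, e1, e2. *)
Definition harmonic_map (v : R -> R -> R) (t : R) : vmap := fun x y =>
  let g1 := flow2 (conn_x v t) (conn_y v t) (mkV3 1 0 0) x y in
  let g2 := flow2 (conn_x v t) (conn_y v t) (mkV3 0 1 0) x y in
  mkV3 (c1 g1) (c1 g2) (c1 (cross g1 g2)).

(** A square matrix with orthonormal columns has orthonormal rows; the sign of the determinant is
    fixed because the third column is the cross product of the first two. *)
Lemma orthonormal_rows (a b : V3) :
  dot a a = 1 -> dot b b = 1 -> dot a b = 0 ->
  let g := cross a b in
  let p := mkV3 (c1 a) (c1 b) (c1 g) in
  let e := mkV3 (c2 a) (c2 b) (c2 g) in
  let f := mkV3 (c3 a) (c3 b) (c3 g) in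
  dot p p = 1 /\ dot e e = 1 /\ dot f f = 1 /\
  dot p e = 0 /\ dot p f = 0 /\ dot e f = 0 /\ dot (cross p e) f = 1.
Proof.
  intros Ha Hb Hab g p e f.
  (* A polynomial identity that becomes the completeness relation for a, b, a x b once these are
     orthonormal; evaluation at the standard basis reads off all products of rows. *)
  assert (Gram : forall k l : V3,
    dot k a * dot l a + dot k b * dot l b + dot k g * dot l g =
    dot k l * (dot a a * dot b b - dot a b * dot a b)
    + dot k a * dot l a * (1 - dot b b) + dot k b * dot l b * (1 - dot a a)
    + dot a b * (dot k a * dot l b + dot l a * dot k b)).
  { intros k l; unfold g; vec_ring. }
  rewrite Ha, Hb, Hab in Gram.
  assert (T : dot (cross p e) f = dot a a * dot b b - dot a b * dot a b)
    by (unfold p, e, f, g; vec_ring).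
  rewrite Ha, Hb, Hab in T.
  pose (i := mkV3 1 0 0); pose (j := mkV3 0 1 0); pose (k := mkV3 0 0 1).
  generalize (Gram i i) (Gram j j) (Gram k k) (Gram i j) (Gram i k) (Gram j k).
  unfold i, j, k, dot at 1 2 3 4 5 6 7; cbn [c1 c2 c3]; unfold p, e, f, dot; cbn [c1 c2 c3].
  intros; repeat split; try lra.
  revert T; unfold p, e, f, dot; cbn [c1 c2 c3]; lra.
Qed.

Lemma harmonic_map_spec (v : R -> R -> R) (t : R) :
  sinh_Gordon_solution v ->
  let p := harmonic_map v t in
  vC2 p /\ forall x y,
    dot (p x y) (p x y) = 1 /\
    dot (p x y) (vdx p x y) = 0 /\ dot (p x y) (vdy p x y) = 0 /\
    dot (vdx p x y) (vdx p x y) = 2 * cosh (2 * v x y) + 2 * cos t /\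
    dot (vdy p x y) (vdy p x y) = 2 * cosh (2 * v x y) - 2 * cos t /\
    dot (vdx p x y) (vdy p x y) = - 2 * sin t /\
    omega_sph (p x y) (vdx p x y) (vdy p x y) = 2 * sinh (2 * v x y) /\
    tproj (p x y) (vlap p x y) = vzero.
Proof.
  intros HG p; pose proof (proj1 HG) as HC.
  pose (g1 := flow2 (conn_x v t) (conn_y v t) (mkV3 1 0 0)).
  pose (g2 := flow2 (conn_x v t) (conn_y v t) (mkV3 0 1 0)).
  pose (g3 := fun x y => cross (g1 x y) (g2 x y)).
  assert (S1 : flat_section (conn_x v t) (conn_y v t) g1) by now apply conn_flat_section.
  assert (S2 : flat_section (conn_x v t) (conn_y v t) g2) by now apply conn_flat_section.
  assert (S3 : flat_section (conn_x v t) (conn_y v t) g3) by now apply flat_section_cross.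
  destruct (section_c1_harmonic v t g1 HC S1) as [K1 H1].
  destruct (section_c1_harmonic v t g2 HC S2) as [K2 H2].
  destruct (section_c1_harmonic v t g3 HC S3) as [K3 H3].
  split; [exact (conj K1 (conj K2 K3))|]; intros x y.
  assert (Z : forall u0, flow2 (conn_x v t) (conn_y v t) u0 0 0 = u0)
    by (intros u0; unfold flow2; now rewrite !rot_flow_0).
  assert (O1 : dot (g1 x y) (g1 x y) = 1).
  { rewrite (flat_section_dot _ _ _ _ x y S1 S1); unfold g1; rewrite Z; vec_ring. }
  assert (O2 : dot (g2 x y) (g2 x y) = 1).
  { rewrite (flat_section_dot _ _ _ _ x y S2 S2); unfold g2; rewrite Z; vec_ring. }
  assert (O12 : dot (g1 x y) (g2 x y) = 0).
  { rewrite (flat_section_dot _ _ _ _ x y S1 S2); unfold g1, g2; rewrite !Z; vec_ring. }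
  destruct (orthonormal_rows _ _ O1 O2 O12) as (Opp & Oee & Off & Ope & Opf & Oef & Odet).
  pose (P := p x y).
  pose (e := mkV3 (c2 (g1 x y)) (c2 (g2 x y)) (c2 (g3 x y))).
  pose (f := mkV3 (c3 (g1 x y)) (c3 (g2 x y)) (c3 (g3 x y))).
  change (dot P P = 1) in Opp; change (dot e e = 1) in Oee; change (dot f f = 1) in Off.
  change (dot P e = 0) in Ope; change (dot P f = 0) in Opf; change (dot e f = 0) in Oef.
  change (dot (cross P e) f = 1) in Odet.
  destruct (H1 x y) as (X1 & Y1 & L1), (H2 x y) as (X2 & Y2 & L2), (H3 x y) as (X3 & Y3 & L3).
  pose (c := cos (t / 2)); pose (s := sin (t / 2)).
  fold c s in X1, X2, X3, Y1, Y2, Y3.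
  pose (a1 := 2 * c * cosh (v x y)); pose (a2 := 2 * s * sinh (v x y)).
  pose (b1 := - 2 * s * cosh (v x y)); pose (b2 := 2 * c * sinh (v x y)).
  assert (EX : vdx p x y = vadd (vscal a1 e) (vscal a2 f)).
  { unfold vdx, vadd, vscal; cbn [e f c1 c2 c3]; f_equal; assumption. }
  assert (EY : vdy p x y = vadd (vscal b1 e) (vscal b2 f)).
  { unfold vdy, vadd, vscal; cbn [e f c1 c2 c3]; f_equal; assumption. }
  assert (EL : vlap p x y = vscal (- (4 * cosh (2 * v x y))) P).
  { unfold vlap, vadd, vscal; f_equal; assumption. }
  fold P; rewrite EX, EY, EL.
  assert (Hsc : s * s + c * c = 1) by exact (sin2_cos2 (t / 2)).
  (* The frame carries the phase e^(it/2), and quadratic expressions in p_z carry its square; the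
     double-angle formulas bring back t. *)
  assert (Hct : cos t = c * c - s * s).
  { replace t with (2 * (t / 2)) at 1 by field; rewrite cos_2a; reflexivity. }
  assert (Hst : sin t = 2 * s * c).
  { replace t with (2 * (t / 2)) at 1 by field; rewrite sin_2a; reflexivity. }
  generalize (cosh_sqr (v x y)); intros Hcs.
  pose (ch := cosh (v x y)); pose (sh := sinh (v x y)); fold ch sh in Hcs.
  assert (Quad : forall k l m n : R,
    dot (vadd (vscal k e) (vscal l f)) (vadd (vscal m e) (vscal n f))
    = k * m * dot e e + l * n * dot f f + (k * n + l * m) * dot e f) by (intros; vec_ring).
  assert (Lin : forall k l : R,
    dot P (vadd (vscal k e) (vscal l f)) = k * dot P e + l * dot P f) by (intros; vec_ring).
  rewrite !Quad, !Lin, Oee, Off, Oef, Ope, Opf, Hct, Hst, cosh_double, sinh_double.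
  fold ch sh; unfold a1, a2, b1, b2; fold ch sh.
  split; [exact Opp|]; split; [ring|]; split; [ring|].
  split; [|split; [|split; [|split]]].
  - transitivity (4 * (c * c) * (ch * ch) + 4 * (s * s) * (sh * sh)); [ring|].
    rewrite Hcs; replace (s * s) with (1 - c * c) by lra; ring.
  - transitivity (4 * (s * s) * (ch * ch) + 4 * (c * c) * (sh * sh)); [ring|].
    rewrite Hcs; replace (s * s) with (1 - c * c) by lra; ring.
  - transitivity (- 4 * (s * c) * (ch * ch) + 4 * (s * c) * (sh * sh)); [ring|].
    rewrite Hcs; ring.
  - unfold omega_sph, Jsph.
    (* The area form evaluates to the determinant of the coefficients of p_x, p_y in (e1, e2), times
       the determinant 1 of the frame. *)
    transitivity ((2 * c * ch * (2 * c * sh) - 2 * s * sh * (- 2 * s * ch)) * dot (cross P e) f);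
      [vec_ring|].
    rewrite Odet; transitivity (4 * (s * s + c * c) * (sh * ch)); [ring|]; rewrite Hsc; ring.
  - unfold tproj.
    assert (E : forall k, vadd (vscal k P) (vscal (- dot (vscal k P) P) P)
      = vscal (k * (1 - dot P P)) P) by (intros; vec_ring).
    rewrite E, Opp; unfold vzero; vec_ring.
Qed.

(** * The surface and its invariants *)

Lemma cdot_cJ (n u w : V3) :
  dot n n = 1 -> dot n u = 0 -> dot n w = 0 ->
  let z := (vscal (/ 2) u, vscal (- / 2) w) in
  cdot (cJ n z) (cJ n z) = ((dot u u - dot w w) / 4, - dot u w / 2).
Proof.
  intros Hn Hu Hw z; unfold z, cdot, cJ, Jsph; cbn [fst snd].
  (* Lagrange's identity: J is an isometry of the tangent plane, so <J p_z, J p_z> = <p_z, p_z>, and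
     the Hopf coefficient needs only the first fundamental forms of the factors. *)
  assert (L : forall k l a b, dot (cross n (vscal k a)) (cross n (vscal l b))
    = k * l * (dot n n * dot a b - dot n a * dot n b)) by (intros; vec_ring).
  rewrite !L, Hn, Hu, Hw; f_equal; [field|].
  assert (dot w u = dot u w) by vec_ring; rewrite H; field.
Qed.

Lemma cosh_sum_prod (a b : R) :
  2 * cosh (2 * a) + 2 * cosh (2 * b) = 4 * cosh (a + b) * cosh (a - b).
Proof.
  unfold cosh; replace (- (2 * a)) with (- a + - a) by ring.
  replace (- (2 * b)) with (- b + - b) by ring.
  replace (2 * a) with (a + a) by ring; replace (2 * b) with (b + b) by ring.
  replace (- (a + b)) with (- a + - b) by ring; replace (- (a - b)) with (- a + b) by ring.
  replace (a - b) with (a + - b) by ring; rewrite !exp_plus.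
  generalize (exp_plus a (- a)) (exp_plus b (- b)); rewrite !Rplus_opp_r, exp_0; intros Ha Hb.
  transitivity (exp a * exp a + exp (- a) * exp (- a) + exp b * exp b + exp (- b) * exp (- b));
    [field|].
  transitivity ((exp a * exp a + exp (- a) * exp (- a)) * (exp b * exp (- b)) +
    (exp b * exp b + exp (- b) * exp (- b)) * (exp a * exp (- a))); [|field].
  rewrite <- Ha, <- Hb; ring.
Qed.

Lemma sinh_sum_prod (a b : R) :
  2 * sinh (2 * a) + 2 * sinh (2 * b) = 4 * sinh (a + b) * cosh (a - b).
Proof.
  unfold sinh, cosh; replace (- (2 * a)) with (- a + - a) by ring.
  replace (- (2 * b)) with (- b + - b) by ring.
  replace (2 * a) with (a + a) by ring; replace (2 * b) with (b + b) by ring.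
  replace (- (a + b)) with (- a + - b) by ring; replace (- (a - b)) with (- a + b) by ring.
  replace (a - b) with (a + - b) by ring; rewrite !exp_plus.
  generalize (exp_plus a (- a)) (exp_plus b (- b)); rewrite !Rplus_opp_r, exp_0; intros Ha Hb.
  transitivity (exp a * exp a - exp (- a) * exp (- a) + exp b * exp b - exp (- b) * exp (- b));
    [field|].
  transitivity ((exp a * exp a - exp (- a) * exp (- a)) * (exp b * exp (- b)) +
    (exp b * exp b - exp (- b) * exp (- b)) * (exp a * exp (- a))); [|field].
  rewrite <- Ha, <- Hb; ring.
Qed.

Lemma tanh_sqr_neq_1 (x : R) : tanh x ^ 2 <> 1.
Proof.
  unfold tanh; generalize (cosh_sqr x) (cosh_pos x); intros H P E.
  assert (K : sinh x * sinh x = (sinh x / cosh x) ^ 2 * (cosh x * cosh x)) by (field; lra).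
  rewrite E in K; lra.
Qed.

Theorem theorem4p4 (v w : R -> R -> R) :
  sinh_Gordon_solution v -> sinh_Gordon_solution w ->
  exists Phi : R -> (vmap * vmap)%type,
    forall t : R,
      let p := fst (Phi t) in let q := snd (Phi t) in
      minimal_immersion p q /\
      no_complex_points p q /\
      induced_metric_is p q
        (fun x y => 4 * cosh (v x y + w x y) * cosh (v x y - w x y)) /\
      (forall x y, Kahler_C1 p q x y = tanh (v x y - w x y) /\
                   Kahler_C2 p q x y = tanh (v x y + w x y)) /\
      (forall x y, Hopf_coeff p q x y = (cos t, sin t)).
Proof.
  intros Hv Hw.
  (* The shift by pi makes <q_z, q_z> = - e^(it): it cancels <p_z, p_z> in the metric, while the
     minus sign in J_2 makes the two add up in the Hopf differential, where the factor 1/2 restores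
     e^(it). The sign of w gives q the Jacobian - 2 sinh (2 w), so that the sum of the Jacobians
     produces v - w in C_1 and their difference v + w in C_2; the metric, even in w, does not
     change. *)
  exists (fun t => (harmonic_map v t, harmonic_map (fun x y => - w x y) (t + PI))).
  intros t; cbn [fst snd].
  destruct (harmonic_map_spec v t Hv) as [Cp Sp].
  destruct (harmonic_map_spec _ (t + PI) (sinh_Gordon_solution_opp w Hw)) as [Cq Sq].
  set (p := harmonic_map v t) in *.
  set (q := harmonic_map (fun x y => - w x y) (t + PI)) in *.
  pose (lam x y := 4 * cosh (v x y + w x y) * cosh (v x y - w x y)).
  assert (Hlam : forall x y, 0 < lam x y).
  { intros x y; unfold lam.
    apply Rmult_lt_0_compat; [apply Rmult_lt_0_compat; [lra|]|]; apply cosh_pos. }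
  assert (Hdbl : forall x y, cosh (2 * - w x y) = cosh (2 * w x y)).
  { intros x y; replace (2 * - w x y) with (- (2 * w x y)) by ring; apply cosh_opp. }
  assert (Met : induced_metric_is p q lam).
  { intros x y; unfold metE, metF, metG, pdot, Phi_x, Phi_y, lam; cbn [fst snd].
    destruct (Sp x y) as (_ & _ & _ & Exp & Eyp & Exyp & _).
    destruct (Sq x y) as (_ & _ & _ & Exq & Eyq & Exyq & _).
    rewrite Exp, Eyp, Exyp, Exq, Eyq, Exyq, Hdbl, neg_cos, neg_sin, <- cosh_sum_prod.
    split3; ring. }
  assert (Area : forall x y, area_density p q x y = lam x y).
  { intros x y; unfold area_density; destruct (Met x y) as (-> & -> & ->).
    replace (lam x y * lam x y - 0 ^ 2) with (lam x y * lam x y) by ring.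
    apply sqrt_square; left; apply Hlam. }
  assert (Kah : forall x y, Kahler_C1 p q x y = tanh (v x y - w x y) /\
                            Kahler_C2 p q x y = tanh (v x y + w x y)).
  { intros x y; unfold Kahler_C1, Kahler_C2, pullback_omega1, pullback_omega2.
    rewrite Area.
    destruct (Sp x y) as (_ & _ & _ & _ & _ & _ & -> & _).
    destruct (Sq x y) as (_ & _ & _ & _ & _ & _ & -> & _).
    generalize (cosh_pos (v x y + w x y)) (cosh_pos (v x y - w x y)); intros P1 P2.
    generalize (sinh_sum_prod (v x y) (- w x y)) (sinh_sum_prod (v x y) (w x y)).
    replace (v x y + - w x y) with (v x y - w x y) by ring.
    replace (v x y - - w x y) with (v x y + w x y) by ring.
    replace (2 * - w x y) with (- (2 * w x y)) by ring; rewrite sinh_opp.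
    intros E1 E2; unfold lam, tanh; split.
    - rewrite E1; field; lra.
    - replace (2 * sinh (2 * v x y) - 2 * - sinh (2 * w x y))
        with (2 * sinh (2 * v x y) + 2 * sinh (2 * w x y)) by ring.
      rewrite E2; field; lra. }
  split; [|split; [|split; [exact Met|split; [exact Kah|]]]].
  - split; [exact Cp|]; split; [exact Cq|]; split; [|split; [|split]].
    + intros x y; split; [apply Sp | apply Sq].
    + intros x y; destruct (Met x y) as (-> & -> & ->); generalize (Hlam x y); nra.
    + intros x y; destruct (Met x y) as (-> & -> & ->); split; reflexivity.
    + intros x y; unfold mean_curvature.
      destruct (Sp x y) as (_ & _ & _ & _ & _ & _ & _ & ->).
      destruct (Sq x y) as (_ & _ & _ & _ & _ & _ & _ & ->).
      assert (Z : forall k, vscal k vzero = vzero) by (intros; unfold vzero; vec_ring).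
      now rewrite !Z.
  - intros x y; destruct (Kah x y) as [-> ->]; split; apply tanh_sqr_neq_1.
  - intros x y; unfold Hopf_coeff.
    destruct (Sp x y) as (Np & Txp & Typ & Exp & Eyp & Exyp & _).
    destruct (Sq x y) as (Nq & Txq & Tyq & Exq & Eyq & Exyq & _).
    assert (Neg : forall z, cdot z (cneg z) = Copp (cdot z z)).
    { intros [a b]; unfold cdot, cneg, Copp; cbn [fst snd]; f_equal; vec_ring. }
    rewrite Neg; unfold vdz; rewrite !cdot_cJ by assumption.
    rewrite Exp, Eyp, Exyp, Exq, Eyq, Exyq, neg_cos, neg_sin.
    unfold Cmult, Cplus, Copp, RtoC; cbn [fst snd]; f_equal; field.
Qed.
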